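(* Let $(b_j^k)_{1\le k\le j}$ be the unique family of polynomials in $\mathbb{Z}[q]$ satisfying $b_j^j=1$ for $j\ge1$, $b_j^1=(1-q^2)\cdots(1-q^j)$ for $j\ge2$, and $b_j^k=b_{j-1}^{k-1}+(1-q^j)\,b_{j-1}^k-b_{j-2}^{k-1}$ for $2\le k\le j-1$. For every integer $n\ge1$, the Poincaré polynomial $a_n=a_n(q)$ of the set of fully commutative elements of the Coxeter group $W(A_n)$ is given by $$ \begin{aligned} a_n=\ &-\frac{1}{q^{n+2}(1-q^2)}\sum_{s=0}^{n+1}(-1)^{s+1}\sum_{n+3=v_0>v_1>\cdots>v_s>v_{s+1}=1}\ \prod_{u=0}^{s}b_{v_u}^{v_{u+1}}\\ =\ &-\frac{1}{q^{n+2}(1-q^2)}\sum_{s=0}^{n+1}(-1)^{s+1}\sum_{n+3=v_0>v_1>\cdots>v_s>v_{s+1}=1}\ \prod_{u=0}^{s}\Bigg[(1-\psi(v_{u+1}))\,\Pi(v_{u+1}+2,v_u)\\ &\quad+\sum_{t=1}^{v_{u+1}-1}(1-\psi(t))\sum_{r=1}^{\min\{v_u-v_{u+1}-1,\,v_{u+1}-t\}}\ \sum_{d_1+\cdots+d_r=v_{u+1}-t}\Sigma\Pi(t+2,v_u)[d_1+1,\dots,d_r+1]\Bigg], \end{aligned} $$ where $\psi(k)=q^2+\cdots+q^{k+1}$ for $k\ge1$, the sums over $v_0>\cdots>v_{s+1}$ run over all strictly decreasing sequences of integers with $v_0=n+3$ and $v_{s+1}=1$, and the indices $d_1,\dots,d_r$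 are positive integers.
   Context: Superscripts in $b_j^k$ are indices, not exponents. For a positive integer $n$, $W(A_n)$ is the Coxeter group with generators $\sigma_1,\dots,\sigma_n$ and relations $\sigma_i^2=1$, $\sigma_i\sigma_{i+1}\sigma_i=\sigma_{i+1}\sigma_i\sigma_{i+1}$ for $1\le i\le n-1$, and $\sigma_i\sigma_j=\sigma_j\sigma_i$ for $|i-j|\ge 2$. The length $l(w)$ is the minimal number of generators in an expression of $w$; expressions of this length are called reduced. An element is fully commutative if any of its reduced expressions can be obtained from any other by applying only commutation relations $\sigma_i\sigma_j=\sigma_j\sigma_i$, $|i-j|\ge2$; $W^c(A_n)$ is the set of fully commutative elements of $W(A_n)$, and $a_n=\sum_{w\in W^c(A_n)}q^{l(w)}$. Define $\Pi(a,b)=\prod_{t=a}^{b}(1-q^t)$ for $1\le a\le b$ and $\Pi(a,b)=1$ for $a>b$. Let $l_1,\dots,l_p\ge 2$ be integers and let $i_1,\dots,i_p$ be integers with $a\le i_1$, $i_t+l_t\le i_{t+1}$ for $1\le t<p$, and $i_p+l_p-1\le b$. Then $\Pi(a,b)[i_1(l_1),\dots,i_p(l_p)]$ denotes the polynomial obtained from the product $\Pi(a,b)$ by replacing, for each $t=1,\dots,p$, the subproduct of $l_t$ consecutive factors $(1-q^{i_t})\cdots(1-q^{i_t+l_t-1})$ by the monomial $-q^{i_t}$. Further, $\Sigma\Pi(a,b)[l_1,\dots,l_p]$ is the sum of $\Pi(a,b)[i_1(l_1),\dots,i_p(l_p)]$ over all integer tuples $(i_1,\dots,i_p)$ satisfying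 $a\le i_1$, $i_t+l_t\le i_{t+1}$ for $1\le t<p$, and $i_p+l_p-1\le b$; it is $0$ if there are none. Empty sums are $0$. *)

(* Defs.v *)
From HB Require Import structures.
From mathcomp Require Import all_boot all_order all_algebra.
From mathcomp Require Import boolp classical_sets fsbigop.
From mathcomp Require Import zify.
From Stdlib Require Import Relation_Operators.

Set Implicit Arguments.
Unset Strict Implicit.
Unset Printing Implicit Defensive.

Import GRing.Theory.
Local Open Scope quotient_scope.
Local Open Scope ring_scope.

(* The Coxeter group W(A_n).  The generators sigma_1, ..., sigma_n are indexed
   by 'I_n, the index i standing for sigma_{i+1}.  Since sigma_i^2 = 1 the
   generators are their own inverses, so W(A_n) is the monoid of words in the
   generators modulo the congruence generated by the Coxeter relations, and
   the inverse of a word is its reversal. *)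

Variant coxeter_relator n : seq 'I_n -> seq 'I_n -> Prop :=
| RelSquare i : coxeter_relator [:: i; i] [::]
| RelBraid (i j : 'I_n) : j = i.+1 :> nat ->
    coxeter_relator [:: i; j; i] [:: j; i; j]
| RelComm (i j : 'I_n) : (i.+2 <= j)%N ->
    coxeter_relator [:: i; j] [:: j; i].

Variant coxeter_step n : seq 'I_n -> seq 'I_n -> Prop :=
| CoxeterStep u v l r : coxeter_relator l r ->
    coxeter_step (u ++ l ++ v) (u ++ r ++ v).

Definition coxeter_equiv n (s t : seq 'I_n) : bool :=
  `[< clos_refl_sym_trans _ (@coxeter_step n) s t >].

Lemma coxeter_equivP n (s t : seq 'I_n) :
  reflect (clos_refl_sym_trans _ (@coxeter_step n) s t) (coxeter_equiv s t).
Proof. exact: asboolP. Qed.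

Lemma coxeter_equiv_refl n : reflexive (@coxeter_equiv n).
Proof. by move=> s; apply/coxeter_equivP/rst_refl. Qed.

Lemma coxeter_equiv_sym n : symmetric (@coxeter_equiv n).
Proof.
by move=> s t; apply/coxeter_equivP/coxeter_equivP => h; apply: rst_sym.
Qed.

Lemma coxeter_equiv_trans n : transitive (@coxeter_equiv n).
Proof.
move=> t s u /coxeter_equivP st /coxeter_equivP tu.
by apply/coxeter_equivP; apply: rst_trans st tu.
Qed.

Canonical coxeter_equivRel n :=
  EquivRel (@coxeter_equiv n) (@coxeter_equiv_refl n)
    (@coxeter_equiv_sym n) (@coxeter_equiv_trans n).

Definition WA n := {eq_quot (coxeter_equivRel n)}.
HB.instance Definition _ n := Choice.on (WA n).
HB.instance Definition _ n := EqQuotient.on (WA n).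

Definition WA_of n (s : seq 'I_n) : WA n := \pi_(WA n) s.

Lemma WA_ofP n (s t : seq 'I_n) :
  WA_of s = WA_of t <-> clos_refl_sym_trans _ (@coxeter_step n) s t.
Proof.
split=> [/eqP|st].
  by rewrite /WA_of eqmodE => /coxeter_equivP.
by apply/eqP; rewrite /WA_of eqmodE; apply/coxeter_equivP.
Qed.

Lemma WA_ofK n (w : WA n) : WA_of (repr w) = w.
Proof. exact: reprK. Qed.

Definition WA_mul n (x y : WA n) : WA n := WA_of (repr x ++ repr y).
Definition WA_inv n (x : WA n) : WA n := WA_of (rev (repr x)).

Lemma coxeter_catl n (u s t : seq 'I_n) :
  clos_refl_sym_trans _ (@coxeter_step n) s t ->
  clos_refl_sym_trans _ (@coxeter_step n) (u ++ s) (u ++ t).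
Proof.
elim=> [{}s {}t [a b l r lr]|{}s|{}s {}t _ IH|x y z _ IH1 _ IH2].
- by rewrite !(catA u a); apply/rst_step/CoxeterStep.
- exact: rst_refl.
- exact: rst_sym.
- exact: rst_trans IH1 IH2.
Qed.

Lemma coxeter_catr n (u s t : seq 'I_n) :
  clos_refl_sym_trans _ (@coxeter_step n) s t ->
  clos_refl_sym_trans _ (@coxeter_step n) (s ++ u) (t ++ u).
Proof.
elim=> [{}s {}t [a b l r lr]|{}s|{}s {}t _ IH|x y z _ IH1 _ IH2].
- by rewrite -!catA; apply/rst_step/CoxeterStep.
- exact: rst_refl.
- exact: rst_sym.
- exact: rst_trans IH1 IH2.
Qed.

Lemma coxeter_rev n (s t : seq 'I_n) :
  clos_refl_sym_trans _ (@coxeter_step n) s t ->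
  clos_refl_sym_trans _ (@coxeter_step n) (rev s) (rev t).
Proof.
elim=> [{}s {}t [a b l r lr]|{}s|{}s {}t _ IH|x y z _ IH1 _ IH2].
- rewrite !rev_cat -!catA; case: lr => [i|i j ij|i j ij].
  + exact/rst_step/CoxeterStep/RelSquare.
  + exact/rst_step/CoxeterStep/RelBraid.
  + exact/rst_sym/rst_step/CoxeterStep/RelComm.
- exact: rst_refl.
- exact: rst_sym.
- exact: rst_trans IH1 IH2.
Qed.

Lemma WA_mulE n (s t : seq 'I_n) : WA_mul (WA_of s) (WA_of t) = WA_of (s ++ t).
Proof.
apply/WA_ofP; apply: (rst_trans _ _ _ (s ++ repr (WA_of t))).
  by apply/coxeter_catr/WA_ofP; rewrite WA_ofK.
by apply/coxeter_catl/WA_ofP; rewrite WA_ofK.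
Qed.

Lemma WA_invE n (s : seq 'I_n) : WA_inv (WA_of s) = WA_of (rev s).
Proof. by apply/WA_ofP/coxeter_rev/WA_ofP; rewrite WA_ofK. Qed.

Lemma WA_mulA n : associative (@WA_mul n).
Proof.
move=> x y z; rewrite -(WA_ofK x) -(WA_ofK y) -(WA_ofK z).
by rewrite !WA_mulE catA.
Qed.

Lemma WA_mul1 n : left_id (WA_of [::]) (@WA_mul n).
Proof. by move=> x; rewrite -(WA_ofK x) WA_mulE. Qed.

Lemma WA_mulr1 n : right_id (WA_of [::]) (@WA_mul n).
Proof. by move=> x; rewrite -(WA_ofK x) WA_mulE cats0. Qed.

Lemma coxeter_rev_cat n (s : seq 'I_n) : WA_of (rev s ++ s) = WA_of [::].
Proof.
elim: s => [//|i s IH]; rewrite -[RHS]IH; apply/WA_ofP.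
rewrite rev_cons cat_rcons.
exact: (rst_step _ _ _ _ (CoxeterStep (rev s) s (RelSquare i))).
Qed.

Lemma WA_mulV n : left_inverse (WA_of [::]) (@WA_inv n) (@WA_mul n).
Proof.
by move=> x; rewrite -(WA_ofK x) WA_invE WA_mulE coxeter_rev_cat.
Qed.

Lemma WA_mulrV n : right_inverse (WA_of [::]) (@WA_inv n) (@WA_mul n).
Proof.
move=> x; rewrite -(WA_ofK x) WA_invE WA_mulE -{1}(revK (repr x)).
exact: coxeter_rev_cat.
Qed.

HB.instance Definition _ n := isGroup.Build (WA n) (@WA_mulA n) (@WA_mul1 n)
  (@WA_mulr1 n) (@WA_mulV n) (@WA_mulrV n).

Definition sigma n (i : 'I_n) : WA n := WA_of [:: i].

Definition word_prod n (s : seq 'I_n) : WA n := (\prod_(i <- s) sigma i)%g.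

Lemma word_prodE n (s : seq 'I_n) : word_prod s = WA_of s.
Proof.
rewrite /word_prod; elim: s => [|i s IH]; first by rewrite big_nil.
by rewrite big_cons IH [LHS]WA_mulE.
Qed.

Lemma ex_word n (w : WA n) :
  exists k, [exists s : k.-tuple 'I_n, word_prod s == w].
Proof.
exists (size (repr w)); apply/existsP; exists (in_tuple (repr w)).
by rewrite word_prodE WA_ofK.
Qed.

Definition len n (w : WA n) : nat := ex_minn (ex_word w).

Definition reduced_expr n (w : WA n) (s : seq 'I_n) : Prop :=
  word_prod s = w /\ size s = len w.

Variant comm_step n : seq 'I_n -> seq 'I_n -> Prop :=
| CommStep (u v : seq 'I_n) (i j : 'I_n) : (i.+2 <= j)%N || (j.+2 <= i)%N ->
    comm_step (u ++ [:: i; j] ++ v) (u ++ [:: j; i] ++ v).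

Definition fully_commutative n (w : WA n) : Prop :=
  forall s t, reduced_expr w s -> reduced_expr w t ->
    clos_refl_trans _ (@comm_step n) s t.

Definition WAc n : set (WA n) := [set w | fully_commutative w]%classic.
Arguments WAc n : clear implicits.

(* A finitely supported sum: W(A_n) is finite. *)
Definition poincare_fc n : {poly int} :=
  \sum_(w \in WAc n) ('X^(len w) : {poly int}).

(* b j k stands for b_j^k; nothing is required outside 1 <= k <= j.  The
   lemmas is_bfamily_uniq and bfamilyP below show that these conditions
   determine a unique family on that range. *)
Definition is_bfamily (b : nat -> nat -> {poly int}) : Prop :=
  [/\ forall j, (1 <= j)%N -> b j j = 1,
      forall j, (2 <= j)%N -> b j 1%N = \prod_(2 <= t < j.+1) (1 - 'X^t)
    & forall j k, (2 <= k)%N -> (k <= j - 1)%N ->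
        b j k = b (j - 1)%N (k - 1)%N + (1 - 'X^j) * b (j - 1)%N k
                - b (j - 2)%N (k - 1)%N].

Lemma is_bfamily_uniq (b c : nat -> nat -> {poly int}) :
  is_bfamily b -> is_bfamily c ->
  forall j k, (1 <= k <= j)%N -> b j k = c j k.
Proof.
move=> [b0 b1 b2] [c0 c1 c2]; elim/ltn_ind => j IH k /andP[k0 kj].
have [->|kNj] := eqVneq k j.
  by have j0 := leq_trans k0 kj; rewrite (b0 j j0) (c0 j j0).
have {kNj}kj : (k < j)%N by rewrite ltn_neqAle kNj.
have [->|kN1] := eqVneq k 1%N.
  by have j2 := leq_ltn_trans k0 kj; rewrite (b1 j j2) (c1 j j2).
have k2 : (2 <= k)%N by rewrite ltn_neqAle eq_sym kN1.
have kj1 : (k <= j - 1)%N by lia.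
rewrite (b2 j k k2 kj1) (c2 j k k2 kj1).
rewrite (IH (j - 1)%N _ (k - 1)%N); [|lia|lia].
rewrite (IH (j - 1)%N _ k); [|lia|lia].
by rewrite (IH (j - 2)%N _ (k - 1)%N); [|lia|lia].
Qed.

Fixpoint bfamily (j k : nat) {struct j} : {poly int} :=
  if j is j1.+1 then
    if k == j then 1
    else if k == 1%N then \prod_(2 <= t < j.+1) (1 - 'X^t)
    else bfamily j1 k.-1 + (1 - 'X^j) * bfamily j1 k
         - (if j1 is j2.+1 then bfamily j2 k.-1 else 0)
  else 0.

Lemma bfamilySS j k : bfamily j.+2 k =
  if k == j.+2 then 1
  else if k == 1%N then \prod_(2 <= t < j.+3) (1 - 'X^t)
  else bfamily j.+1 k.-1 + (1 - 'X^(j.+2)) * bfamily j.+1 k - bfamily j k.-1.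
Proof. by []. Qed.

Lemma bfamilyP : is_bfamily bfamily.
Proof.
split=> [[|j] j0|[|[|j]] j2|[|[|j]] k k2 kj]; [lia| |lia|lia| |lia|lia|].
- by rewrite [LHS]/= eqxx.
- by [].
- have kN : (k == j.+2) = false by apply/negbTE; lia.
  have kN1 : (k == 1%N) = false by apply/negbTE; lia.
  by rewrite bfamilySS kN kN1 !subSS !subn0 subn1.
Qed.

Definition psi (k : nat) : {poly int} := \sum_(2 <= m < k.+2) 'X^m.

Definition Pi (a b : nat) : {poly int} := \prod_(a <= t < b.+1) (1 - 'X^t).

(* The lists l_1, ..., l_p and i_1, ..., i_p are functions on 'I_p, shifted to
   start at 0; the entries of l are meant to be at least 2, so that the
   truncated subtraction of 1 is harmless. *)
Definition admissible p (a b : nat) (l i : 'I_p -> nat) : bool :=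
  [&& [forall t : 'I_p, (t == 0 :> nat) ==> (a <= i t)%N],
      [forall t : 'I_p, forall t' : 'I_p,
         (t' == t.+1 :> nat) ==> (i t + l t <= i t')%N]
    & [forall t : 'I_p, (t.+1 == p) ==> (i t + l t - 1 <= b)%N]].

Definition Pi_repl p (a b : nat) (l i : 'I_p -> nat) : {poly int} :=
  (\prod_(t < p) - 'X^(i t)) *
  \prod_(a <= x < b.+1 | ~~ [exists t : 'I_p, (i t <= x < i t + l t)%N])
    (1 - 'X^x).

(* Admissible positions satisfy i t <= i t + l t - 1 <= b because l t >= 2, so
   they can be taken in 'I_b.+1. *)
Definition SigmaPi p (a b : nat) (l : 'I_p -> nat) : {poly int} :=
  \sum_(i : {ffun 'I_p -> 'I_b.+1} | admissible a b l (fun t => i t))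
    Pi_repl a b l (fun t => i t).

(* The bracketed factor, with j and k for v_u and v_{u+1}; it is only used for
   1 <= k < j. *)
Definition bracket (j k : nat) : {poly int} :=
  (1 - psi k) * Pi (k + 2) j +
  \sum_(1 <= t < k) (1 - psi t) *
    \sum_(1 <= r < (minn (j - k - 1) (k - t)).+1)
      \sum_(d : {ffun 'I_r -> 'I_(k - t).+1} |
              [forall x, (0 < d x)%N] && ((\sum_x d x)%N == (k - t)%N))
        SigmaPi (t + 2) j (fun x => (d x).+1).

Definition is_chain s (m : nat) (v : {ffun 'I_s.+2 -> 'I_m.+1}) : bool :=
  [&& v ord0 == m :> nat, v ord_max == 1%N :> nat
    & [forall x : 'I_s.+2, forall y : 'I_s.+2, (x < y)%N ==> (v y < v x)%N]].

Definition chain_sum (n : nat) (c : nat -> nat -> {poly int}) : {poly int} :=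
  \sum_(0 <= s < n.+2) (-1) ^+ s.+1 *
    \sum_(v : {ffun 'I_s.+2 -> 'I_(n + 3).+1} | is_chain v)
      \prod_(u < s.+1) c (v (inord u)) (v (inord u.+1)).

Notation "p %:F" := (@FracField.tofrac _ p) : ring_scope.

(* Main.v *)
Require Import Defs.
From mathcomp Require Import all_boot all_order all_algebra.
From mathcomp Require Import perm boolp classical_sets fsbigop.
From mathcomp Require Import zify ring.
From Stdlib Require Import Relation_Operators.

Set Implicit Arguments.
Unset Strict Implicit.
Unset Printing Implicit Defensive.

Import GRing.Theory.

(** A fully commutative element of W(A_n) has a unique Jones normal form: a
    product of descending runs of generators i, i - 1, ..., j whose starting
    points i and whose end points j both increase strictly from one run to
    the next. Prepending a letter to such a word gives, up to commutations,
    either another such word or a word with a factor ii or iji, i and j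
    adjacent (jones_cons); a reduced word of a fully commutative element
    never reaches the second case (fc_no_relator). Conversely the
    permutation of a Jones word avoids the pattern 321 and has as many
    inversions as the word has letters. For such permutations all reduced
    words are related by commutations alone (ascending_ncomm), so the
    element is fully commutative, and the permutation determines the form.
    Hence a_n counts Jones forms by length (poincare_jones), and reading off
    the first run gives a recursion for that count (jones_gf).

    For fixed j put F_j(z) = sum_k b_j^k z^k. The definition of the family b
    says that F_j = (z + 1 - q^j) F_(j-1) - z F_(j-2), with F_0 = 0 and F_1
    = z. The signed sum over chains is the entry (n + 3, 1) of the inverse
    of the unitriangular matrix (b_j^k), that is, the value at z^(n+3) of
    the linear functional which sends z to 1 and kills F_j for all j >= 2
    (signed_chain_weight). Expanding z^m on the basis F_h turns the values
    of this functional into weighted sums over paths with steps +1, 0, -1,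
    -2, ... (moment_row), and these paths satisfy, up to the factor -
    q^(n+2) (1 - q^2), the recursion of Jones forms (lukasiewicz_gfE). This
    is the first equality.

    For the second one, the polynomial sum_k z^k bracket(j, k) satisfies the
    same recursion. The sums of products with replaced blocks, weighted by z
    to the total length of the blocks minus their number, have a recursion
    on the last cell of the window: it is either a factor 1 - q^x or the end
    of a block, and shortening the last block by one cell makes the second
    contribution telescope (all_partsSS). *)

(** * Words up to commutation *)

(** Letters are natural numbers here, so that words can be built without
    carrying bounds; they are turned into generators of W(A_n) only later. *)
Variant ncomm_step : seq nat -> seq nat -> Prop :=
| NCommStep u v i j : (i.+2 <= j)%N || (j.+2 <= i)%N ->
    ncomm_step (u ++ [:: i; j] ++ v) (u ++ [:: j; i] ++ v).

Definition ncomm := clos_refl_trans _ ncomm_step.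

Lemma ncomm_refl s : ncomm s s. Proof. exact: rt_refl. Qed.
Lemma ncomm_trans t s u : ncomm s t -> ncomm t u -> ncomm s u.
Proof. exact: rt_trans. Qed.

Lemma ncomm_catl u s t : ncomm s t -> ncomm (u ++ s) (u ++ t).
Proof.
elim=> [_ _ [a b i j ij]|x|x y z _ IH1 _ IH2].
- by rewrite !(catA u a); apply/rt_step/NCommStep.
- exact: ncomm_refl.
- exact: ncomm_trans IH1 IH2.
Qed.

Lemma ncomm_cons k s t : ncomm s t -> ncomm (k :: s) (k :: t).
Proof. exact: (@ncomm_catl [:: k]). Qed.

Lemma ncomm_sym s t : ncomm s t -> ncomm t s.
Proof.
elim=> [_ _ [a b i j ij]|x|x y z _ IH1 _ IH2].
- by apply/rt_step/NCommStep; rewrite orbC.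
- exact: ncomm_refl.
- exact: ncomm_trans IH2 IH1.
Qed.

Lemma ncomm_swap i j s : (i.+2 <= j)%N || (j.+2 <= i)%N ->
  ncomm (i :: j :: s) (j :: i :: s).
Proof. by move=> ij; apply/rt_step; apply: (@NCommStep [::] s i j). Qed.

Lemma ncomm_perm s t : ncomm s t -> perm_eq s t.
Proof.
elim=> [_ _ [a b i j ij]|x|x y z _ IH1 _ IH2] //.
  by rewrite perm_cat2l perm_cat2r; apply/seq.permP => p /=; rewrite addnCA.
exact: perm_trans IH1 IH2.
Qed.

Lemma ncomm_move k s t : all (fun i => (i.+2 <= k)%N || (k.+2 <= i)%N) s ->
  ncomm (k :: s ++ t) (s ++ k :: t).
Proof.
elim: s => [_|i s IH /= /andP[ik sk]]; first exact: ncomm_refl.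
apply: ncomm_trans (ncomm_swap _ _) _; first by rewrite orbC.
exact/ncomm_cons/IH.
Qed.

(** * The permutation of a word *)

Definition swap (i x : nat) : nat :=
  if x == i then i.+1 else if x == i.+1 then i else x.

(** Prefixing a letter k to the word exchanges the values of the permutation at
    k and k + 1, so that words are analysed from their first letter. *)
Definition act (s : seq nat) (x : nat) : nat := foldl (fun y k => swap k y) x s.

Lemma act_cons k s x : act (k :: s) x = act s (swap k x). Proof. by []. Qed.
Lemma act_cat s t x : act (s ++ t) x = act t (act s x).
Proof. by rewrite /act foldl_cat. Qed.

Lemma swapL i : swap i i = i.+1. Proof. by rewrite /swap eqxx. Qed.
Lemma swapR i : swap i i.+1 = i.
Proof. by rewrite /swap eqxx gtn_eqF. Qed.
Lemma swapD i x : x != i -> x != i.+1 -> swap i x = x.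
Proof. by rewrite /swap => /negbTE -> /negbTE ->. Qed.

Variant swap_spec i x : nat -> Prop :=
| SwapL of x = i : swap_spec i x i.+1
| SwapR of x = i.+1 : swap_spec i x i
| SwapD of x <> i & x <> i.+1 : swap_spec i x x.

Lemma swapP i x : swap_spec i x (swap i x).
Proof. by rewrite /swap; case: eqP => ?; [|case: eqP => ?]; constructor. Qed.

(* The innermost swaps are split first: once its argument is a variable, each
   case is a linear condition on that variable. *)
Ltac swap_cases :=
  repeat match goal with |- context [swap ?i ?x] =>
    lazymatch x with context [swap] => fail | _ => case: (swapP i x) => * end
  end.

Lemma swapK i : involutive (swap i).
Proof. by move=> x; swap_cases; lia. Qed.

Lemma act_inj s : injective (act s).
Proof.
elim: s => [|k s IH] x y //; rewrite !act_cons => /IH.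
by apply: can_inj; apply: swapK.
Qed.

Lemma act_coxeter n (s t : seq 'I_n) :
  clos_refl_sym_trans _ (@coxeter_step n) s t ->
  act (map val s) =1 act (map val t).
Proof.
elim=> [_ _ [u v l r lr]|x|x y _ IH|x y z _ IH1 _ IH2] w //; last first.
- by rewrite IH1.
- rewrite !map_cat !act_cat; congr act; move: (act _ w) => {}w.
  case: lr => [i|i j ij|i j ij] /=.
  + exact: swapK.
  + rewrite /= ij; move: (i : nat) => {ij j} {}i.
    by swap_cases; lia.
  + move: (i : nat) (j : nat) ij => {}i {}j ij.
    by swap_cases; lia.
Qed.

Lemma act_ncomm s t : ncomm s t -> act s =1 act t.
Proof.
elim=> [_ _ [u v i j ij]|x|x y z _ IH1 _ IH2] w //; last by rewrite IH1.
rewrite !act_cat; congr act; move: (act _ w) => {}w /=.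
by swap_cases; lia.
Qed.

Arguments act : simpl never.

(** * Inversions *)

Definition inv N (f : nat -> nat) : nat :=
  \sum_(a < N) \sum_(b < N) ((a < b) && (f b < f a))%N.

Lemma sum_swap N i (F : nat -> nat) : (i.+1 < N)%N ->
  (\sum_(a < N) F (swap i a) = \sum_(a < N) F a)%N.
Proof.
move=> iN; pose p := tperm (Ordinal (ltnW iN)) (Ordinal iN).
rewrite [RHS](reindex_inj (@perm_inj _ p)); apply: eq_bigr => a _; congr F.
rewrite /p; case: tpermP => [->|->|ai ai']; rewrite /= ?swapL ?swapR //.
rewrite swapD //; apply/negP => /eqP E; [case: ai|case: ai']; exact: val_inj.
Qed.

(** Exchanging two neighbouring values only affects the pair of positions
    i, i + 1.  The two comparisons are placed so that no subtraction occurs. *)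
Lemma inv_swap N i f : (i.+1 < N)%N ->
  (inv N (f \o swap i) + (f i.+1 < f i) = inv N f + (f i < f i.+1))%N.
Proof.
move=> iN.
have sumd (u v : nat) (c : nat) : (u < N)%N -> (v < N)%N ->
    (\sum_(a < N) \sum_(b < N) ((a == u :> nat) && (b == v :> nat)) * c = c)%N.
  move=> uN vN; rewrite (bigD1 (Ordinal uN)) //= [X in (_ + X)%N]big1 => [|a au].
    rewrite addn0 (bigD1 (Ordinal vN)) //= !eqxx mul1n.
    rewrite big1 ?addn0 // => b bv.
    by rewrite (_ : (b == v :> nat) = false) //; apply/negbTE.
  rewrite big1 // => b _.
  by rewrite (_ : (a == u :> nat) = false) //; apply/negbTE.
(* The exchange is moved from the values to the comparison of positions. *)
have E : inv N (f \o swap i) =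
    (\sum_(a < N) \sum_(b < N) ((swap i a < swap i b) && (f b < f a)))%N.
  pose G a b := ((swap i a < swap i b) && (f b < f a))%N : nat.
  rewrite -[RHS](sum_swap (fun a => \sum_(b < N) G a b)%N iN).
  apply: eq_bigr => a _; rewrite -(sum_swap (fun b => G (swap i a) b) iN).
  by apply: eq_bigr => b _; rewrite /G !swapK.
rewrite E -(sumd i i.+1 (f i.+1 < f i)%N) ?(ltnW iN) //.
rewrite -(sumd i.+1 i (f i < f i.+1)%N) ?(ltnW iN) // /inv -!big_split /=.
apply: eq_bigr => a _; rewrite -!big_split /=; apply: eq_bigr => b _.
case: (swapP i a) => [->|->|a1 a2]; case: (swapP i b) => [->|->|b1 b2];
  rewrite ?ltnn ?eqxx ?leqnn ?ltnSn; lia.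
Qed.

(** Every letter creates an inversion; as inv_act shows, these are the words
    whose length is the number of inversions of their permutation. *)
Fixpoint ascending (s : seq nat) : bool :=
  if s is k :: s1 then (act s1 k < act s1 k.+1)%N && ascending s1 else true.

Lemma inv_act n s : all (fun k => k < n)%N s ->
  (inv n.+1 (act s) <= size s ?= iff ascending s)%N.
Proof.
elim: s => [_|k s IH /= /andP[kn /IH [le_inv eq_inv]]].
  have -> : inv n.+1 (act [::]) = 0%N; last exact: leqif_refl.
  rewrite /inv big1 // => a _; rewrite big1 // => b _.
  by rewrite /act /= (_ : _ && _ = false) //; lia.
have := @inv_swap n.+1 k (act s) kn.
rewrite -[inv _ (act s \o _)]/(inv n.+1 (act (k :: s))).
have := @act_inj s k k.+1; move: (inv _ (act (k :: s))) => x inj E.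
split; first by lia.
by rewrite -eq_inv; apply/idP/idP; lia.
Qed.

(** * Reduced words of 321-avoiding permutations *)

Definition avoids321 (f : nat -> nat) : Prop :=
  forall a b c, (a < b)%N -> (b < c)%N -> ~ ((f c < f b)%N /\ (f b < f a)%N).

(** An ascending letter only adds an inversion, so a pattern 321 in the tail
    keeps its three inversions when the first letter is put back. *)
Lemma avoids321_tail k s : (act s k < act s k.+1)%N ->
  avoids321 (act (k :: s)) -> avoids321 (act s).
Proof.
move=> kk av a b c ab bc [cb ba].
have E x : act (k :: s) (swap k x) = act s x by rewrite act_cons swapK.
have mono x y : (x < y)%N -> (act s y < act s x)%N -> (swap k x < swap k y)%N.
  move=> xy sxy; case: (swapP k x) => [xk|xk|x1 x2];
    case: (swapP k y) => [yk|yk|y1 y2]; subst; lia.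
by apply: (av (swap k a) (swap k b) (swap k c)); rewrite ?E ?mono.
Qed.

Lemma ascending_descent k s : (act s k < act s k.+1)%N ->
  (act (k :: s) k.+1 < act (k :: s) k)%N.
Proof. by rewrite !act_cons swapL swapR. Qed.

(** The first letter of an ascending word is a descent of its permutation.  A
    second descent j next to it would give three decreasing consecutive values;
    hence the first letter commutes with j, and j is moved to the front by
    induction. *)
Lemma exchange s j : ascending s -> avoids321 (act s) ->
  (act s j.+1 < act s j)%N -> exists2 r, ncomm s (j :: r) & ascending (j :: r).
Proof.
elim: s => [_ _|i s IH /= /andP[ii asc] av desc].
  by rewrite /act ltnNge leqnSn.
have [ij|ij] := eqVneq i j.
  by exists s; rewrite -ij; [exact: ncomm_refl|rewrite /= ii].
have desci := ascending_descent ii.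
have far : (i.+2 <= j)%N || (j.+2 <= i)%N.
  case: ltnP => //= ji; rewrite ltnNge; apply/negP => ij'.
  have [jE|iE] : j = i.+1 \/ i = j.+1 by move: ij; rewrite neq_ltn; lia.
    by subst j; case: (av i i.+1 i.+2).
  by subst i; case: (av j j.+1 j.+2).
have [r sr asc_r] : exists2 r, ncomm s (j :: r) & ascending (j :: r).
  apply: IH => //; first exact: avoids321_tail ii av.
  by move: desc; rewrite !act_cons !swapD //; apply/eqP; lia.
exists (i :: r).
  exact: ncomm_trans (ncomm_cons i sr) (ncomm_swap _ far).
move: asc_r ii => /= /andP[jj ->]; rewrite !(act_ncomm sr) !act_cons.
have [-> ->] : swap i j = j /\ swap i j.+1 = j.+1.
  by rewrite !swapD //; apply/eqP; lia.
have [-> ->] : swap j i = i /\ swap j i.+1 = i.+1.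
  by rewrite !swapD //; apply/eqP; lia.
by rewrite jj => ->.
Qed.

Lemma ascending_ncomm s t : ascending s -> ascending t -> avoids321 (act s) ->
  act s =1 act t -> ncomm s t.
Proof.
elim: s t => [|i s IH] t ascs asct av st.
  case: t asct st => [|k t /= /andP[kk _] st].
    by move=> *; exact: ncomm_refl.
  have := ascending_descent kk; rewrite -!st.
  by rewrite /act /= ltnNge leqnSn.
have /= /andP[ii asc] := ascs.
have [r tr /= /andP[_ asc_r]] : exists2 r, ncomm t (i :: r) & ascending (i :: r).
  apply: exchange => //.
    by move=> a b c; rewrite -!st; apply: av.
  by rewrite -!st; apply: ascending_descent.
apply: ncomm_trans (ncomm_sym tr); apply/ncomm_cons/IH => //.
  exact: avoids321_tail ii av.
move=> x; have := st (swap i x); rewrite (act_ncomm tr) !act_cons.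
by rewrite swapK.
Qed.

(** * Jones normal forms *)

Definition run (i j : nat) : seq nat := rev (iota j (i - j).+1).

Fixpoint jones_word (l : seq (nat * nat)) : seq nat :=
  if l is (i, j) :: l1 then run i j ++ jones_word l1 else [::].

(** A pair (i, j) stands for the run i, i - 1, ..., j.  The bounds u and d are
    the least values allowed for the next i and the next j. *)
Fixpoint jones_form (n u d : nat) (l : seq (nat * nat)) : bool :=
  if l is (i, j) :: l1 then
    [&& (u <= i)%N, (d <= j)%N, (j <= i)%N, (i < n)%N
      & jones_form n i.+1 j.+1 l1]
  else true.

Lemma mem_run i j k : (j <= i)%N -> (k \in run i j) = (j <= k <= i)%N.
Proof. by move=> ji; rewrite mem_rev mem_iota; apply/idP/idP; lia. Qed.

Lemma runS i j : (j <= i)%N -> run i.+1 j = i.+1 :: run i j.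
Proof.
move=> ji; rewrite /run subSn // -[(i - j).+2]addn1 iotaD rev_cat /=.
by congr (_ :: _); lia.
Qed.

Lemma runnn i : run i i = [:: i]. Proof. by rewrite /run subnn. Qed.

Lemma run_head i j : (j <= i)%N ->
  exists2 y, run i j = i :: y & all (fun m => m < i)%N y.
Proof.
move=> ji; exists (rev (iota j (i - j))); last first.
  by apply/allP => m; rewrite mem_rev mem_iota; lia.
by rewrite /run -addn1 iotaD rev_cat /= subnKC.
Qed.

Lemma run_split i j k : (j <= k < i)%N -> exists x y,
  run i j = x ++ [:: k.+1; k] ++ y /\ all (fun m => k.+2 <= m)%N x.
Proof.
move=> /andP[jk ki]; exists (rev (iota k.+2 (i - k.+1))), (rev (iota j (k - j))).
split; last by apply/allP => m; rewrite mem_rev mem_iota; lia.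
rewrite /run; have -> : ((i - j).+1 = (k - j) + (2 + (i - k.+1)))%N by lia.
by rewrite iotaD [iota _ (2 + _)]iotaD subnKC // addn2 !rev_cat -catA.
Qed.

Lemma size_run i j : size (run i j) = (i - j).+1.
Proof. by rewrite size_rev size_iota. Qed.

(** The factors to which a Coxeter relation other than a commutation applies. *)
Definition has_relator (t : seq nat) : Prop := exists u v i,
  t = u ++ [:: i; i] ++ v \/
  exists2 j, i = j.+1 \/ j = i.+1 & t = u ++ [:: i; j; i] ++ v.

Lemma has_relator_catl u t : has_relator t -> has_relator (u ++ t).
Proof.
case=> [a [b [i [->|[j ij ->]]]]]; exists (u ++ a), b, i.
  by left; rewrite -catA.
by right; exists j; rewrite // -catA.
Qed.

(** The letter k is compared with the first run i, ..., j. For k < j it is a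
    run of its own, for k = i + 1 it prolongs the run unless the next run
    also starts with i + 1, and for k > i + 1 it commutes past the run. In
    the remaining cases it meets its own copy, next to it or with a single
    neighbour in between. *)
Lemma jones_cons n u d k l : jones_form n u d l ->
  (u <= k)%N -> (d <= k)%N -> (k < n)%N ->
  exists2 t, ncomm (k :: jones_word l) t &
    has_relator t \/ exists2 l', jones_form n u d l' & t = jones_word l'.
Proof.
elim: l u d => [|[i j] l IH] u d /= jl uk dk kn.
  exists [:: k]; first exact: ncomm_refl.
  by right; exists [:: (k, k)]; rewrite /= ?uk ?dk ?leqnn ?kn //= runnn.
have /and5P[ui dj ji i_n jl'] := jl.
have [kj|jk] := ltnP k j.
  exists (k :: run i j ++ jones_word l); first exact: ncomm_refl.
  right; exists ((k, k) :: (i, j) :: l); last by rewrite /= runnn.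
  by rewrite /= uk dk leqnn kn kj ji i_n jl' (leq_trans kj ji).
have [ki|ik] := ltnP k i.
  have [|x [y [-> xk]]] := @run_split i j k; first by rewrite jk.
  exists (x ++ [:: k; k.+1; k] ++ y ++ jones_word l).
    rewrite -!catA; apply: ncomm_move.
    by apply: sub_all xk => m ->; rewrite orbT.
  by left; exists x, (y ++ jones_word l), k; right; exists k.+1; first right.
have [y yE yi] := run_head ji.
have [ki|ki] := eqVneq k i.
  exists (k :: run i j ++ jones_word l); first exact: ncomm_refl.
  by left; exists [::], (y ++ jones_word l), i; left; rewrite ki yE.
have [kE|ki'] := eqVneq k i.+1; last first.
  have ki2 : (i.+1 < k)%N by lia.
  have [|t lt ht] := IH _ _ jl' (ltnW ki2) _ kn; first by lia.
  exists (run i j ++ t).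
    apply: ncomm_trans (ncomm_catl _ lt).
    apply: ncomm_move; apply/allP => x; rewrite mem_run //; lia.
  case: ht => [bt|[l' jl2 ->]]; first by left; apply: has_relator_catl.
  by right; exists ((i, j) :: l') => //=; rewrite ui dj ji i_n.
case: l jl jl' IH => [|[i' j'] l] jl jl' _.
  exists (run k j ++ [::]); first by rewrite kE runS //; exact: ncomm_refl.
  by right; exists [:: (k, j)]; rewrite //= uk dj kn kE ltnW.
have /= /and5P[ii' jj' ji' i'n jl''] := jl'.
have [ki3|ki3] := ltnP k i'.
  exists (run k j ++ jones_word ((i', j') :: l)).
    by rewrite kE runS //; exact: ncomm_refl.
  right; exists ((k, j) :: (i', j') :: l) => //=.
  by rewrite uk dj kn jj' ji' i'n jl'' ki3 andbT /= kE ltnW.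
have {ki3 ii'} i'E : i' = i.+1 by lia.
have [z zE _] := run_head ji'.
exists ([:: i.+1; i; i.+1] ++ y ++ z ++ jones_word l);
  last by left; exists [::], (y ++ z ++ jones_word l), i.+1; right;
    exists i; first left.
rewrite kE yE /= zE i'E.
apply/(@ncomm_catl [:: i.+1; i])/ncomm_sym/(@ncomm_move _ y).
by apply: sub_all yi => m /=; lia.
Qed.

Lemma jones_normal n s : all (fun k => k < n)%N s ->
  exists2 t, ncomm s t &
    has_relator t \/ exists2 l, jones_form n 0 0 l & t = jones_word l.
Proof.
elim: s => [_|k s IH /= /andP[kn /IH[t st [bt|[l jl tE]]]]].
- by exists [::]; [exact: ncomm_refl|right; exists [::]].
- exists (k :: t); first exact: ncomm_cons.
  by left; apply: (@has_relator_catl [:: k]).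
- have [//|//|//|t' lt' ht'] := jones_cons (k := k) jl.
  by exists t' => //; apply: ncomm_trans lt'; rewrite -tE; apply: ncomm_cons.
Qed.

Lemma act_run i j x : (j <= i)%N -> act (run i j) x =
  if x == i.+1 then j else if (j <= x <= i)%N then x.+1 else x.
Proof.
elim: i x => [|i IH] x.
  rewrite leqn0 => /eqP ->; rewrite runnn /act /=.
  by case: (swapP 0 x) => *; do 2?case: ifP; lia.
rewrite leq_eqVlt => /orP[/eqP ->|ji].
  rewrite runnn /act /=.
  by case: (swapP i.+1 x) => *; do 2?case: ifP; lia.
rewrite runS // act_cons IH //.
by case: (swapP i.+1 x) => *; do 4?case: ifP; lia.
Qed.

(** The run i, ..., j moves the value j to position i + 1 and shifts the
    values in between; these positions are where the permutation takes
    values smaller than the position. *)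
Definition anti_excedances (l : seq (nat * nat)) : seq nat :=
  [seq p.1.+1 | p <- l].

(** The permutation of a Jones form increases on its anti-excedances and on the
    other positions.  The bounds u and d make the induction work: they keep the
    later anti-excedances beyond i + 1 and the later values beyond j. *)
Lemma jones_act n u d l : jones_form n u d l ->
  [/\ forall x, (x < d)%N -> act (jones_word l) x = x,
      forall x, x \in anti_excedances l ->
        [&& (u < x)%N, (d <= act (jones_word l) x)%N
          & (act (jones_word l) x < x)%N],
      forall x, x \notin anti_excedances l -> (x <= act (jones_word l) x)%N,
      {in anti_excedances l &, {homo act (jones_word l) : x y / (x < y)%N}}
    & {in [predC anti_excedances l] &,
        {homo act (jones_word l) : x y / (x < y)%N}}].
Proof.
elim: l u d => [|[i j] l IH] u d /=; first by split.
move=> /and5P[ui dj ji i_n /IH[fix_l P_l C_l mP mC]].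
have E x := act_cat (run i j) (jones_word l) x.
have fi : act (jones_word l) (act (run i j) i.+1) = j.
  by rewrite act_run // eqxx fix_l.
have runP x : x \in anti_excedances l -> act (run i j) x = x.
  move=> /P_l /and3P[ix _ _]; rewrite act_run // gtn_eqF // ifF //; lia.
have runC x : x != i.+1 -> x \notin anti_excedances l ->
    act (run i j) x \notin anti_excedances l.
  move=> xi xP; rewrite act_run // (negbTE xi); case: ifP => // /andP[_ xi'].
  by apply/negP => /P_l/andP[]; lia.
split=> [x xd|x|x|x y|x y].
- rewrite E act_run //; have xj : (x < j)%N by apply: leq_trans dj.
  rewrite ltn_eqF ?ltnS; last by apply: leq_trans ji; apply: ltnW.
  by rewrite leqNgt xj /= fix_l // ltnW.
- rewrite inE => /orP[/eqP ->|xP]; rewrite E.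
    by rewrite fi !ltnS ui dj ji.
  rewrite runP //; have /and3P[ix jx fx] := P_l x xP.
  by rewrite fx (leq_trans dj (ltnW jx)) andbT (leq_trans _ ix) // ltnS ltnW.
- rewrite inE negb_or => /andP[xi xP]; rewrite E.
  apply: leq_trans (C_l _ (runC x xi xP)).
  by rewrite act_run // (negbTE xi); case: ifP.
- rewrite !inE !E => /orP[/eqP ->|xP] /orP[/eqP ->|yP] xy.
  + by rewrite ltnn in xy.
  + by rewrite fi runP //; have /and3P[] := P_l y yP.
  + by have /and3P[ix _ _] := P_l x xP; lia.
  + by rewrite !runP //; apply: mP.
- rewrite !inE !E !negb_or => /andP[xi xP] /andP[yi yP] xy.
  apply: mC; rewrite ?inE ?runC //.
  rewrite !act_run // (negbTE xi) (negbTE yi).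
  by case: ifP; case: ifP; lia.
Qed.

(** Two of three positions lie in the same one of two sets on which the
    permutation increases. *)
Lemma jones_avoids321 n u d l : jones_form n u d l ->
  avoids321 (act (jones_word l)).
Proof.
move=> /jones_act[_ _ _ mP mC] a b c ab bc [cb ba].
have K (T : pred nat) x y :
    {in T &, {homo act (jones_word l) : x y / (x < y)%N}} ->
    (x < y)%N -> (act (jones_word l) y < act (jones_word l) x)%N ->
    x \in T -> y \in T -> False.
  by move=> mT xy yx xT yT; have := mT x y xT yT xy; lia.
have ac := ltn_trans ab bc; have ca := ltn_trans cb ba.
have KP := K [in anti_excedances l] _ _ mP.
have KC := K [predC anti_excedances l] _ _ mC.
have [aP|aP] := boolP (a \in anti_excedances l);
have [bP|bP] := boolP (b \in anti_excedances l);
have [cP|cP] := boolP (c \in anti_excedances l);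
  first [ exact: (KP a b) | exact: (KP b c) | exact: (KP a c)
  | exact: (KC a b) | exact: (KC b c) | exact: (KC a c) ].
Qed.

(** While a run is read from its last letter, the value j travels from position
    j to position i + 1, past values that are all larger than j. *)
Lemma jones_ascending n u d l : jones_form n u d l -> ascending (jones_word l).
Proof.
elim: l u d => [|[i j] l IH] u d //= /and5P[ui dj ji i_n jl].
have [fix_l P_l C_l _ _] := jones_act jl.
have asc_l := IH _ _ jl.
have up k : (k <= i)%N -> (k < act (jones_word l) k.+1)%N.
  by move=> ki; apply: C_l; apply/negP => /P_l /andP[]; lia.
have H k : (j <= k <= i)%N -> ascending (run k j ++ jones_word l).
  elim: k => [|k IHk]; first by rewrite leqn0 andbT => /eqP ->;
    rewrite runnn /= asc_l andbT fix_l // up.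
  rewrite leq_eqVlt andb_orl => /orP[/andP[/eqP <- ji']|/andP[jk ki]].
    by rewrite runnn /= asc_l andbT fix_l // up.
  rewrite runS //= IHk ?andbT; last by lia.
  rewrite !act_cat !act_run // eqxx fix_l // gtn_eqF // ifF; last lia.
  by apply: leq_trans (up _ ki); lia.
by apply: H; rewrite ji leqnn.
Qed.

Lemma act_catl_inj s t t' : act (s ++ t) =1 act (s ++ t') -> act t =1 act t'.
Proof.
elim: s => //= k s IH E; apply: IH => x.
by have := E (swap k x); rewrite !act_cons swapK.
Qed.

(** The first run can be read off the permutation: i + 1 is the least
    anti-excedance and j is the value there. *)
Lemma jones_act_inj n u d l l' : jones_form n u d l -> jones_form n u d l' ->
  act (jones_word l) =1 act (jones_word l') -> l = l'.
Proof.
elim: l l' u d => [|[i j] l IH] [|[i' j'] l'] u d //.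
- move=> _ jl' E; have [_ P _ _ _] := jones_act jl'.
  by have := P i'.+1 (mem_head _ _); rewrite -E /act /= ltnn !andbF.
- move=> jl _ E; have [_ P _ _ _] := jones_act jl.
  by have := P i.+1 (mem_head _ _); rewrite E /act /= ltnn !andbF.
move=> jl jl' E.
have [_ P C _ _] := jones_act jl; have [_ P' C' _ _] := jones_act jl'.
have := jl; have := jl' => /= /and5P[ui' dj' ji' i'n jl2'] /and5P[ui dj ji i_n jl2].
have [_ Q _ _ _] := jones_act jl2; have [_ Q' _ _ _] := jones_act jl2'.
have /and3P[_ _ Pi] := P i.+1 (mem_head _ _).
have /and3P[_ _ Pi'] := P' i'.+1 (mem_head _ _).
have ii' : i = i'.
  have : i'.+1 \in anti_excedances ((i, j) :: l).
    by apply: contraLR Pi' => /C; rewrite -E -leqNgt.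
  have : i.+1 \in anti_excedances ((i', j') :: l').
    by apply: contraLR Pi => /C'; rewrite E -leqNgt.
  rewrite !inE => /orP[/eqP[]//|/Q'/and3P[? _ _]] /orP[/eqP[]//|/Q/and3P[? _ _]].
  by lia.
subst i'; have jj' : j = j'.
  have := E i.+1; rewrite /= !act_cat !act_run // eqxx.
  have [F _ _ _ _] := jones_act jl2; have [F' _ _ _ _] := jones_act jl2'.
  by rewrite F // F'.
subst j'; congr (_ :: _); apply: IH jl2 jl2' _.
exact: act_catl_inj E.
Qed.

(** * Counting Jones forms *)

Lemma jones_word_bound n u d l : jones_form n u d l ->
  all (fun k => k < n)%N (jones_word l).
Proof.
elim: l u d => [|[i j] l IH] u d //= /and5P[_ _ ji i_n /IH jl].
rewrite all_cat jl andbT; apply/allP => k; rewrite mem_run //; lia.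
Qed.

(** All forms on the m letters u, ..., u + m - 1, sorted by whether a run starts
    at u. *)
Fixpoint jones_list (m u d : nat) : seq (seq (nat * nat)) :=
  if m is m1.+1 then
    jones_list m1 u.+1 d ++
    [seq (u, j) :: l | j <- index_iota d u.+1, l <- jones_list m1 u.+1 j.+1]
  else [:: [::]].

Lemma mem_jones_list m u d l :
  (l \in jones_list m u d) = jones_form (u + m) u d l.
Proof.
elim: m u d l => [|m IH] u d l.
  case: l => [|[i j] l]; rewrite inE //= addn0.
  by apply/esym/negbTE/negP => /and5P[]; lia.
rewrite /= mem_cat IH addSnnS; apply/orP/idP => [[|/allpairsPdep[j [l' []]]]|].
- by case: l => [|[i j] l] //= /and5P[/ltnW -> -> -> -> ->].
- rewrite mem_index_iota IH addSnnS => /andP[dj ju] jl ->.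
  by rewrite /= leqnn dj -ltnS ju jl -{1}[u]addn0 ltn_add2l.
case: l => [|[i j] l] /=; first by left.
move=> /and5P[ui dj ji i_n jl].
have [ui'|ui'] := ltnP u i; first by left; rewrite dj ji i_n.
have iu : i = u by apply/anti_leq; rewrite ui ui'.
subst i; right; apply/allpairsPdep; exists j, l.
by rewrite mem_index_iota dj ltnS ji IH addSnnS.
Qed.

Lemma uniq_jones_list m u d : uniq (jones_list m u d).
Proof.
elim: m u d => [|m IH] u d //=; rewrite cat_uniq IH /=; apply/andP; split.
  apply/hasPn => _ /allpairsPdep[j [l [_ _ ->]]] /=.
  by rewrite mem_jones_list /= ltnn.
apply: allpairs_uniq_dep => [|j _|[j l] [j' l'] _ _ /= [-> ->]] //.
exact: iota_uniq.
Qed.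

Local Open Scope ring_scope.

(** Only the difference g = u - d of the two bounds matters for the number
    of forms: a run from u to u - e has length e + 1 and leaves the
    difference e. *)
Fixpoint jones_gf (m g : nat) : {poly int} :=
  if m is m1.+1
  then jones_gf m1 g.+1 + \sum_(0 <= e < g.+1) 'X^(e.+1) * jones_gf m1 e
  else 1.

Lemma sum_jones_list m d g :
  \sum_(l <- jones_list m (d + g) d) 'X^(size (jones_word l)) = jones_gf m g.
Proof.
elim: m d g => [|m IH] d g; first by rewrite big_seq1.
rewrite /= big_cat /= -addnS IH; congr (_ + _).
rewrite big_allpairs_dep /=.
transitivity (\sum_(d <= j < d + g.+1)
   'X^((d + g - j).+1) * jones_gf m (d + g - j)).
  rewrite addnS; apply: eq_big_nat => j /andP[dj ju].
  rewrite -(IH j.+1) (_ : (j.+1 + (d + g - j) = (d + g).+1)%N); last lia.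
  rewrite big_distrr /=; apply: eq_bigr => l _.
  by rewrite size_cat size_run exprD.
rewrite -{1}[d]add0n big_addn (_ : (d + g.+1 - d = g.+1)%N); last lia.
rewrite big_nat_rev /=; apply: eq_big_nat => e eg.
by rewrite (_ : (d + g - (0 + g.+1 - e.+1 + d) = e)%N) //; lia.
Qed.

(** * Fully commutative elements *)

Definition ordw n (s : seq nat) : seq 'I_n := pmap insub s.

Lemma val_ordw n s : all (fun k => k < n)%N s -> map val (ordw n s) = s.
Proof.
move=> sn; rewrite /ordw (pmap_filter (insubK _)); apply/all_filterP.
by apply: sub_all sn => k kn; rewrite isSome_insub.
Qed.

Lemma ordw_val n (s : seq 'I_n) : ordw n (map val s) = s.
Proof. exact: (map_pK valK). Qed.

Lemma all_val n (s : seq 'I_n) : all (fun k => k < n)%N (map val s).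
Proof. by apply/allP => _ /mapP[i _ ->]; apply: ltn_ord. Qed.

Lemma ordw_cat n s t : ordw n (s ++ t) = ordw n s ++ ordw n t.
Proof. exact: pmap_cat. Qed.

Lemma comm_val n (s t : seq 'I_n) :
  clos_refl_trans _ (@comm_step n) s t -> ncomm (map val s) (map val t).
Proof.
elim=> [_ _ [u v i j ij]|x|x y z _ IH1 _ IH2].
- by rewrite !map_cat; apply/rt_step/NCommStep.
- exact: ncomm_refl.
- exact: ncomm_trans IH1 IH2.
Qed.

Lemma comm_ordw n s t : ncomm s t -> all (fun k => k < n)%N s ->
  clos_refl_trans _ (@comm_step n) (ordw n s) (ordw n t).
Proof.
elim=> [_ _ [u v i j ij]|x|x y z xy IH1 _ IH2] sn.
- move: sn; rewrite !all_cat /= => /and3P[_ /and3P[i_n jn _] _].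
  have E k l (kn : (k < n)%N) (ln : (l < n)%N) :
      ordw n [:: k; l] = [:: Ordinal kn; Ordinal ln].
    by rewrite /ordw /= !insubT.
  rewrite 2!(ordw_cat _ u) (ordw_cat _ [:: i; j]) (ordw_cat _ [:: j; i]).
  rewrite (E i j) (E j i).
  exact/rt_step/CommStep.
- exact: rt_refl.
- apply: (rt_trans _ _ _ (ordw n y)); [exact: IH1|apply: IH2].
  by rewrite -(perm_all _ (ncomm_perm xy)).
Qed.

Lemma comm_word_prod n (s t : seq 'I_n) :
  clos_refl_trans _ (@comm_step n) s t -> word_prod s = word_prod t.
Proof.
move=> st; rewrite !word_prodE; apply/WA_ofP.
elim: st => [_ _ [u v i j ij]|x|x y z _ IH1 _ IH2].
- have [ij'|ji] := orP ij; first by apply/rst_step/CoxeterStep/RelComm.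
  by apply/rst_sym/rst_step/CoxeterStep/RelComm.
- exact: rst_refl.
- exact: rst_trans IH1 IH2.
Qed.

Lemma word_prod_step n (u v l r : seq 'I_n) : coxeter_relator l r ->
  word_prod (u ++ l ++ v) = word_prod (u ++ r ++ v).
Proof.
by move=> lr; rewrite !word_prodE; apply/WA_ofP/rst_step/CoxeterStep.
Qed.

Lemma word_prod_act n (s t : seq 'I_n) : word_prod s = word_prod t ->
  act (map val s) =1 act (map val t).
Proof. by rewrite !word_prodE => /WA_ofP; apply: act_coxeter. Qed.

Lemma len_min n (s : seq 'I_n) : (len (word_prod s) <= size s)%N.
Proof.
rewrite /len; case: ex_minnP => k _ kmin; apply: kmin.
by apply/existsP; exists (in_tuple s).
Qed.

Lemma ex_reduced n (w : WA n) : exists s, reduced_expr w s.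
Proof.
rewrite /reduced_expr /len; case: ex_minnP => k /existsP[s /eqP sw] _.
by exists s; rewrite size_tuple.
Qed.

Definition jones_elt n l : WA n := word_prod (ordw n (jones_word l)).

Section JonesElement.
Variables (n : nat) (l : seq (nat * nat)).
Hypothesis jl : jones_form n 0 0 l.

Let word_lt_n := jones_word_bound jl.

(** Inversions bound the length from below, whatever word represents the
    element, and a Jones word attains the bound. *)
Lemma reduced_jones (s : seq 'I_n) :
  word_prod s = jones_elt n l -> (size s <= size (jones_word l))%N ->
  ascending (map val s) /\ size s = size (jones_word l).
Proof.
move=> sE sl; have E := word_prod_act sE; rewrite (val_ordw word_lt_n) in E.
have [le_s eq_s] := inv_act (all_val s).
have [_ eq_l] := inv_act word_lt_n; rewrite (jones_ascending jl) in eq_l.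
have invE : inv n.+1 (act (map val s)) = inv n.+1 (act (jones_word l)).
  by apply: eq_bigr => a _; apply: eq_bigr => b _; rewrite !E.
move: le_s eq_s; rewrite size_map invE (eqP eq_l) => le_s.
have ss : size s = size (jones_word l) by apply/anti_leq; rewrite le_s sl.
by rewrite -ss eqxx => <-.
Qed.

Lemma size_ordw_jones : size (ordw n (jones_word l)) = size (jones_word l).
Proof. by rewrite -(size_map val) val_ordw. Qed.

Lemma len_jones : len (jones_elt n l) = size (jones_word l).
Proof.
have [s [sE ss]] := ex_reduced (jones_elt n l).
have [||_ <-] := @reduced_jones s => //; rewrite ss.
by rewrite -size_ordw_jones len_min.
Qed.

Lemma fc_jones : fully_commutative (jones_elt n l).
Proof.
move=> s t [sE ss] [tE tt].
have [||asc_s _] := @reduced_jones s => //; first by rewrite ss len_jones.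
have [||asc_t _] := @reduced_jones t => //; first by rewrite tt len_jones.
rewrite -(ordw_val s) -(ordw_val t); apply: comm_ordw (all_val s).
apply: ascending_ncomm => //; last by apply: word_prod_act; rewrite sE.
move=> a b c; rewrite !(word_prod_act sE) (val_ordw word_lt_n).
exact: jones_avoids321 jl _ _ _.
Qed.

End JonesElement.

Lemma jones_elt_inj n l l' : jones_form n 0 0 l -> jones_form n 0 0 l' ->
  jones_elt n l = jones_elt n l' -> l = l'.
Proof.
move=> jl jl' /word_prod_act E; apply: (jones_act_inj jl jl') => x.
by rewrite -(val_ordw (jones_word_bound jl)) -(val_ordw (jones_word_bound jl')).
Qed.

(** A square would make the word shorter.  A braid relation turns one reduced
    word into another with a different number of occurrences of a letter, and
    no commutation can do that. *)
Lemma fc_no_relator n (w : WA n) s t : fully_commutative w ->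
  reduced_expr w s -> ncomm (map val s) t -> ~ has_relator t.
Proof.
move=> fc [sE ss] st.
have tn : all (fun k => k < n)%N t.
  by rewrite -(perm_all _ (ncomm_perm st)) all_val.
have st' := comm_ordw st (all_val s); rewrite ordw_val in st'.
have sz : size (ordw n t) = size s.
  by rewrite -(size_map val) val_ordw // -(perm_size (ncomm_perm st)) size_map.
have tE : word_prod (ordw n t) = w by rewrite -(comm_word_prod st').
have lt_n k : k \in t -> (k < n)%N by move/(allP tn).
case=> u [v [i ht]].
have i_n : (i < n)%N.
  by apply: lt_n; case: ht => [|[j _]] ->; rewrite !(mem_cat, inE) eqxx ?orbT.
pose i0 := Ordinal i_n.
case: ht => [tt|[j ij tt]].
  have tO : ordw n t = ordw n u ++ [:: i0; i0] ++ ordw n v.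
    rewrite tt 2!ordw_cat; congr (_ ++ _ ++ _).
    by rewrite /ordw /= insubT.
  have := len_min (ordw n u ++ [::] ++ ordw n v).
  rewrite -(word_prod_step _ _ (RelSquare i0)) -tO tE -ss -sz tO.
  by rewrite !size_cat /= addnCA; lia.
have j_n : (j < n)%N by apply: lt_n; rewrite tt !(mem_cat, inE) eqxx ?orbT.
pose j0 := Ordinal j_n.
have tO : ordw n t = ordw n u ++ [:: i0; j0; i0] ++ ordw n v.
  rewrite tt 2!ordw_cat; congr (_ ++ _ ++ _).
  by rewrite /ordw /= !insubT.
have E : word_prod (ordw n u ++ [:: i0; j0; i0] ++ ordw n v) =
         word_prod (ordw n u ++ [:: j0; i0; j0] ++ ordw n v).
  case: ij => ijE; first exact/esym/word_prod_step/RelBraid.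
  exact/word_prod_step/RelBraid.
have tw : reduced_expr w (ordw n t) by rewrite /reduced_expr sz.
have /(fc _ _ tw)/comm_val/ncomm_perm/seq.permP/(_ (pred1 i)) :
    reduced_expr w (ordw n u ++ [:: j0; i0; j0] ++ ordw n v).
  by split; [rewrite -E -tO|rewrite -ss -sz tO !size_cat].
have ji : (j == i) = false by apply/eqP; lia.
by rewrite tO !map_cat !count_cat /= eqxx ji; lia.
Qed.

Lemma fc_is_jones n (w : WA n) : fully_commutative w ->
  exists2 l, jones_form n 0 0 l & w = jones_elt n l.
Proof.
move=> fc; have [s sw] := ex_reduced w.
have [t st [ht|[l jl tl]]] := jones_normal (all_val s).
  by case: (fc_no_relator fc sw st ht).
exists l => //; rewrite /jones_elt -tl.
have := comm_ordw st (all_val s); rewrite ordw_val => /comm_word_prod <-.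
by case: sw.
Qed.

Lemma poincare_jones n : poincare_fc n = jones_gf n 0.
Proof.
rewrite /poincare_fc.
have -> : WAc n = [set` map (jones_elt n) (jones_list n 0 0)]%classic.
  apply/seteqP; split=> w /=.
    case/fc_is_jones => l jl ->; apply: map_f.
    by rewrite mem_jones_list.
  by move=> /mapP[l]; rewrite mem_jones_list => jl ->; apply: fc_jones.
rewrite -fsbig_seq; last first.
  rewrite map_inj_in_uniq ?uniq_jones_list // => l l'.
  by rewrite !mem_jones_list; apply: jones_elt_inj.
rewrite big_map -(sum_jones_list n 0 0) big_seq [RHS]big_seq.
apply: eq_bigr => l; rewrite mem_jones_list => jl.
by rewrite len_jones.
Qed.
(** * Moments of the family b *)

(** Weighted paths of m steps from height g to height 0.  From height h a step
    goes up by one, with weight 1, or to any height e <= h, with weight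
    q^(h + 2). *)
Fixpoint lukasiewicz_gf (m g : nat) : {poly int} :=
  if m is m1.+1
  then lukasiewicz_gf m1 g.+1 +
    'X^(g.+2) * \sum_(0 <= e < g.+1) lukasiewicz_gf m1 e
  else (g == 0%N)%:R.

Lemma sum_delta0 g : \sum_(0 <= e < g.+1) (e == 0%N)%:R = 1 :> {poly int}.
Proof.
by rewrite big_nat_recl //= big1 ?addr0.
Qed.

(** The sum of height and remaining steps does not change in a step up, and a
    step from g to e lowers it by g - e + 1.  Taking this power of q out turns
    the weight q^(g + 2) of the step into the weight q^(e + 1) of a run.  The
    last step, down to 0, does not come from a run and leaves one more q. *)
Lemma lukasiewicz_gfE m g :
  lukasiewicz_gf m.+1 g = 'X^(g + m + 2) * jones_gf m g.
Proof.
elim: m g => [|m IH] g.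
  by rewrite /= sum_delta0 add0r !mulr1 addn0 addn2.
rewrite [LHS]/= -/(lukasiewicz_gf m.+1 g.+1) IH mulrDr.
congr (_ + _); first by congr ('X^_ * _); lia.
rewrite !big_distrr /=; apply: eq_bigr => e _.
rewrite -[_ + _]/(lukasiewicz_gf m.+1 e) IH !mulrA -!exprD.
by congr ('X^_ * _); lia.
Qed.

(** The value at z^m F_(h+1) of the functional that sends F_1 = z to 1 and
    F_j to 0 for j >= 2, where F_j = sum_k b_j^k z^k; see moment_row. *)
Definition moment (m h : nat) : {poly int} :=
  if m is m1.+1 then - (1 - 'X^2) * \sum_(0 <= g < h.+1) lukasiewicz_gf m1 g
  else (h == 0%N)%:R.

(** This lemma and the next are the recursion of the polynomials F_j, read
    through the functional. *)
Lemma moment0S m : moment m 1 = moment m.+1 0 + (1 - 'X^2) * moment m 0.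
Proof.
case: m => [|m]; first by rewrite /= big_nat1 /=; ring.
by rewrite /moment /= !big_nat_recr //= !big_geq //; ring.
Qed.

Lemma momentSS m h : moment m h.+2 =
  moment m.+1 h.+1 + (1 - 'X^(h.+3)) * moment m h.+1 - moment m.+1 h.
Proof.
case: m => [|m].
  by rewrite /= (big_nat_recr h.+1) //=; ring.
rewrite /moment (big_nat_recr h.+2) // [X in _ = _ * X + _ + _]big_nat_recr //=.
set s := \sum_(0 <= g < h.+2) lukasiewicz_gf m g.
by ring.
Qed.

Section Family.
Variables (b : nat -> nat -> {poly int}) (hb : is_bfamily b).

(* Extending the rows by zero makes their recursion hold in every column. *)
Let pad_row h i := if (i <= h)%N then b h.+1 i.+1 else 0.

Lemma pad_rowS0 h : pad_row h.+1 0 = (1 - 'X^(h.+2)) * pad_row h 0.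
Proof.
have [b0 b1 b2] := hb; rewrite /pad_row /= b1 // big_nat_recr //= mulrC.
case: h => [|h]; first by rewrite big_geq // b0.
by rewrite b1.
Qed.

Lemma pad_row11 : pad_row 1 1 = pad_row 0 0.
Proof. by have [b0 _ _] := hb; rewrite /pad_row /= !b0. Qed.

Lemma pad_rowSS h i :
  pad_row h.+2 i.+1 =
  pad_row h.+1 i + (1 - 'X^(h.+3)) * pad_row h.+1 i.+1 - pad_row h i.
Proof.
have [b0 b1 b2] := hb; rewrite /pad_row.
have [ih|[->|hi]] : (i <= h)%N \/ i = h.+1 \/ (h.+2 <= i)%N by lia.
- have hi : (i.+2 <= h.+3 - 1)%N by lia.
  rewrite ih (leqW ih) ltnS (leqW ih) ltnS ih.
  have := @b2 h.+3 i.+2 isT hi; rewrite !subSS [(h.+2 - 0)%N]subn0.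
  by rewrite [(i.+1 - 0)%N]subn0 [(h.+1 - 0)%N]subn0.
- by rewrite !ltnn !leqnn !b0 // mulr0 addr0 subr0.
- have F k : (k < i)%N -> (i <= k)%N = false by lia.
  rewrite ltnS F // F ?(leq_trans _ hi) // ltnS F ?(leq_trans _ hi) //.
  by rewrite mulr0 addr0 subr0.
Qed.

(** Both sides have the same recursion in h, and F_1 = z. *)
Lemma moment_row m h :
  moment m h = \sum_(0 <= i < h.+1) pad_row h i * moment (m + i) 0.
Proof.
have [b0 b1 b2] := hb.
elim/ltn_ind: h m => -[|[|h]] IH m.
- by rewrite big_nat1 /pad_row /= b0 // mul1r addn0.
- rewrite moment0S [RHS]big_nat_recr // big_nat1 addn0 pad_rowS0 pad_row11.
  by rewrite /pad_row /= b0 // addn1 mul1r mulr1 addrC.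
rewrite momentSS (IH h.+1) // (IH h.+1 _ m) // (IH h) //.
rewrite [RHS]big_nat_recl //. rewrite pad_rowS0 addn0.
rewrite [X in _ = _ + X](eq_bigr (fun i => pad_row h.+1 i * moment (m.+1 + i) 0 +
  (1 - 'X^(h.+3)) * (pad_row h.+1 i.+1 * moment (m + i.+1) 0) -
  pad_row h i * moment (m.+1 + i) 0)); last first.
  by move=> i _; rewrite pad_rowSS addnS addSn; ring.
rewrite !sumrB big_split /= -big_distrr /=.
rewrite (big_nat_recl h.+1 _ (fun i => _ i * moment (m + i) 0)) //.
rewrite (big_nat_recr h.+1 _ (fun i => pad_row h.+1 i.+1 * _)) //=.
rewrite (big_nat_recr h.+1 _ (fun i => pad_row h i * _)) //=.
by rewrite [pad_row h h.+1]/pad_row ltnn [pad_row h.+1 h.+2]/pad_row ltnn addn0; ring.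
Qed.

Lemma moment_kills j : (2 <= j)%N ->
  \sum_(1 <= k < j.+1) b j k * moment k.-1 0 = 0.
Proof.
case: j => [|[|j]] // _; have := moment_row 0 j.+1.
rewrite /= big_add1 /= => H; rewrite [RHS]H.
by apply: eq_big_nat => i /andP[_ ij]; rewrite /pad_row ifT.
Qed.

End Family.

(** * Chains *)

Definition ffun_insert p (T : Type) (h : 'I_p.+1) (x : T) (g : {ffun 'I_p -> T}) :
  {ffun 'I_p.+1 -> T} := [ffun i => oapp g x (unlift h i)].

Lemma ffun_insert_id p (T : Type) h (x : T) (g : {ffun 'I_p -> T}) :
  ffun_insert h x g h = x.
Proof. by rewrite ffunE unlift_none. Qed.

Lemma ffun_insert_lift p (T : Type) h (x : T) (g : {ffun 'I_p -> T}) i :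
  ffun_insert h x g (lift h i) = g i.
Proof. by rewrite ffunE liftK. Qed.

Lemma sum_ffun_insert p (T : finType) (V : nmodType) (h : 'I_p.+1)
    (P : pred {ffun 'I_p.+1 -> T}) (F : {ffun 'I_p.+1 -> T} -> V) :
  \sum_(f | P f) F f =
  \sum_(x : T) \sum_(g : {ffun 'I_p -> T} | P (ffun_insert h x g))
     F (ffun_insert h x g).
Proof.
rewrite pair_big_dep /=.
rewrite (reindex (fun u : T * {ffun 'I_p -> T} => ffun_insert h u.1 u.2)) //=.
apply: onW_bij.
exists (fun f : {ffun 'I_p.+1 -> T} => (f h, [ffun i => f (lift h i)])).
  move=> [x g] /=; rewrite ffun_insert_id; congr (_, _).
  by apply/ffunP => i; rewrite ffunE ffun_insert_lift.
move=> f; apply/ffunP => i /=; rewrite ffunE.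
by case: unliftP => [j ->|->] //=; rewrite ffunE.
Qed.

Lemma ffun0_unique (T : Type) (f g : {ffun 'I_0 -> T}) : f = g.
Proof. by apply/ffunP => -[]. Qed.

Lemma sum_ffun0 (T : finType) (V : nmodType) (P : pred {ffun 'I_0 -> T})
    (F : {ffun 'I_0 -> T} -> V) (f0 : {ffun 'I_0 -> T}) :
  \sum_(f | P f) F f = if P f0 then F f0 else 0.
Proof.
rewrite big_mkcond (bigD1 f0) //= big1 ?addr0 // => f.
by rewrite (ffun0_unique f f0) eqxx.
Qed.

(** The chains with p steps from j down to 1, summed by their first step. *)
Fixpoint chain_weight (c : nat -> nat -> {poly int}) (p j : nat) : {poly int} :=
  if p is p1.+1 then \sum_(1 <= k < j) c j k * chain_weight c p1 k
  else (j == 1%N)%:R.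

Lemma chain_weight0 c p : chain_weight c p 0 = 0.
Proof. by case: p => //= p; rewrite big_geq. Qed.

(** The chains of the statement, with a starting point that may lie below the
    bound of the codomain, as needed to remove the first step. *)
Definition chain_from p M (j : nat) (v : {ffun 'I_p.+1 -> 'I_M}) : bool :=
  [&& v ord0 == j :> nat, v ord_max == 1%N :> nat
    & [forall x : 'I_p.+1, forall y : 'I_p.+1, (x < y)%N ==> (v y < v x)%N]].

Lemma chain_fromS p M j x (g : {ffun 'I_p.+1 -> 'I_M}) :
  chain_from j (ffun_insert ord0 x g) =
  (x == j :> nat) && ((g ord0 < j)%N && chain_from (g ord0) g).
Proof.
rewrite /chain_from ffun_insert_id eqxx /=.
have [xj|//] /= := eqVneq (x : nat) j.
have -> : ord_max = lift ord0 (ord_max : 'I_p.+1) by apply: val_inj.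
rewrite ffun_insert_lift andbCA; congr (_ && _).
apply/idP/andP => [/'forall_forallP H|[gj /'forall_forallP H]].
  split; first by have := H ord0 (lift ord0 ord0);
    rewrite ffun_insert_id ffun_insert_lift xj.
  apply/'forall_forallP => y z; have := H (lift ord0 y) (lift ord0 z).
  by rewrite !ffun_insert_lift.
have gle z : (g z <= g ord0)%N.
  have [->//|z0] := eqVneq z ord0.
  by have /implyP := H ord0 z; rewrite lt0n => /(_ z0)/ltnW.
apply/'forall_forallP => y z.
case: (unliftP ord0 y) => [y' ->|->]; case: (unliftP ord0 z) => [z' ->|->];
  rewrite ?ffun_insert_lift ?ffun_insert_id //.
  exact: H.
by rewrite xj (leq_ltn_trans (gle z') gj) implybT.
Qed.

Lemma sum_chain_from (c : nat -> nat -> {poly int}) p M j : (j < M)%N ->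
  \sum_(v : {ffun 'I_p.+1 -> 'I_M} | chain_from j v)
    \prod_(u < p) c (v (inord u)) (v (inord u.+1)) = chain_weight c p j.
Proof.
elim: p j => [|p IH] j jM.
  rewrite (sum_ffun_insert ord0).
  under eq_bigr do rewrite (sum_ffun0 _ _ (ffun0 (card_ord 0))) big_ord0.
  rewrite (bigD1 (Ordinal jM)) //= big1 => [|x xj]; last first.
    rewrite /chain_from ffun_insert_id; case: eqVneq => //= xj'.
    by case/negP: xj; apply/eqP/val_inj.
  rewrite addr0 /chain_from ffun_insert_id eqxx /=.
  have -> : ord_max = ord0 :> 'I_1 by apply: val_inj.
  rewrite ffun_insert_id /=; case: eqP => //= _.
  by case: ifP => // /negP[]; apply/'forall_forallP => -[[|//] ?] [[|//] ?].
rewrite (sum_ffun_insert ord0) (bigD1 (Ordinal jM)) //= [X in _ + X]big1; last first.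
  move=> x xj; rewrite big1 // => g.
  rewrite chain_fromS => /andP[/eqP xj' _].
  by case/negP: xj; apply/eqP/val_inj.
rewrite addr0.
under eq_bigl do rewrite chain_fromS eqxx /=.
have -> : \sum_(1 <= k < j) c j k * chain_weight c p k =
    \sum_(k < M | (k < j)%N) c j k * chain_weight c p k.
  rewrite -(big_mkord (fun k => k < j)%N (fun k => c j k * chain_weight c p k)).
  rewrite -(big_nat_widen 0 j M predT) ?(ltnW jM) //=.
  case: j {jM} => [|j]; first by rewrite !big_geq.
  by rewrite [RHS]big_ltn // chain_weight0 mulr0 add0r.
rewrite (partition_big (fun g : {ffun 'I_p.+1 -> 'I_M} => g ord0)
  (fun k : 'I_M => (k < j)%N)) /=; last first.
  by move=> g /andP[].
apply: eq_bigr => k kj; rewrite -IH ?(leq_ltn_trans (ltnW kj)) // big_distrr.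
apply: eq_big => [g|g /andP[_ /eqP gk]].
  have [->|gk] := eqVneq (g ord0) k; first by rewrite kj andbT.
  rewrite andbF; apply/esym/negbTE/negP => /and3P[/eqP gk' _ _].
  by case/negP: gk; apply/eqP/val_inj.
rewrite big_ord_recl /=; congr (_ * _).
  have -> : inord 0 = ord0 :> 'I_p.+2 by apply: val_inj; rewrite /= inordK.
  have -> : inord 1 = lift ord0 ord0 :> 'I_p.+2.
    by apply: val_inj; rewrite /= inordK.
  by rewrite ffun_insert_id ffun_insert_lift gk.
apply: eq_bigr => u _.
have E i : (i < p.+1)%N -> inord i.+1 = lift ord0 (inord i) :> 'I_p.+2.
  by move=> ip; apply: val_inj; rewrite /= !inordK.
by rewrite /bump /= add1n !E ?ffun_insert_lift ?ltnS ?(ltnW (ltn_ord u)).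
Qed.

Lemma chain_sum_weight n c :
  chain_sum n c = \sum_(0 <= s < n.+2) (-1) ^+ s.+1 * chain_weight c s.+1 (n + 3).
Proof.
apply: eq_bigr => s _; congr (_ * _).
by rewrite -(@sum_chain_from c s.+1 (n + 3).+1).
Qed.

Lemma eq_chain_weight (c c' : nat -> nat -> {poly int}) p j :
  (forall j k, (1 <= k < j)%N -> c j k = c' j k) ->
  chain_weight c p j = chain_weight c' p j.
Proof.
move=> cc'; elim: p j => //= p IH j.
by apply: eq_big_nat => k kj; rewrite cc' // IH.
Qed.

(** The alternating sum over chains expands the inverse of a unitriangular
    matrix, so it is the first column of that inverse.  A chain from j has at
    most j - 1 steps, whence the condition on the range S of the summation. *)
Lemma signed_chain_weight c (x : nat -> {poly int}) :
  x 1%N = 1 ->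
  (forall j, (2 <= j)%N -> x j + \sum_(1 <= k < j) c j k * x k = 0) ->
  forall j S, (2 <= j <= S.+1)%N ->
    \sum_(0 <= s < S) (-1) ^+ s.+1 * chain_weight c s.+1 j = x j.
Proof.
move=> x1 xS; elim/ltn_ind => j IH [|S] /andP[j2 jS]; first by lia.
rewrite big_nat_recl // expr1.
have w1 s : chain_weight c s.+1 1 = 0 by rewrite /= big_geq.
have -> : chain_weight c 1 j = c j 1%N.
  rewrite /= big_ltn //= mulr1 big_nat big1 ?addr0 // => k k1.
  by rewrite (_ : k == 1%N = false) ?mulr0 //; lia.
have -> : \sum_(0 <= s < S) (-1) ^+ s.+2 * chain_weight c s.+2 j =
    - \sum_(2 <= k < j) c j k * x k.
  under eq_bigr => s _ do rewrite [chain_weight _ _ _]/= big_ltn // -/(chain_weight c s.+1 1)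
    w1 mulr0 add0r exprS -mulrA mulN1r big_distrr.
  rewrite sumrN exchange_big /=; congr (- _).
  apply: eq_big_nat => k /andP[k2 kj].
  rewrite -(IH k kj S); last by lia.
  by rewrite big_distrr; apply: eq_bigr => s _ /=; rewrite mulrCA.
have := xS j j2; rewrite big_ltn // x1 mulr1 mulN1r => /eqP.
by rewrite addr_eq0 opprD => /eqP.
Qed.

Lemma chain_sum_jones b n : is_bfamily b ->
  chain_sum n b = - ('X^(n + 2) * (1 - 'X^2)) * jones_gf n 0.
Proof.
move=> hb; rewrite chain_sum_weight.
rewrite (signed_chain_weight (x := fun k => moment k.-1 0)) //; last by lia.
  by rewrite addn3 /= big_nat1 -/(lukasiewicz_gf n.+1 0) lukasiewicz_gfE add0n; ring.
move=> j j2; have := moment_kills hb j2; rewrite big_nat_recr ?(ltnW j2) //=.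
by have [b0 _ _] := hb; rewrite b0 ?mul1r 1?addrC // ltnW.
Qed.
(** * Replaced blocks *)

(** Since blocks are nonempty, comparing consecutive blocks only, and the first
    and the last with the ends of the window, gives all comparisons.  In this
    form the conditions split off the last block. *)
Lemma admissibleP p a b (l i : 'I_p -> nat) : (forall t, (0 < l t)%N) ->
  reflect [/\ forall t, (a <= i t)%N,
              forall t t' : 'I_p, (t < t')%N -> (i t + l t <= i t')%N
            & forall t, (i t + l t <= b.+1)%N]
          (admissible a b l i).
Proof.
move=> l0; apply: (iffP and3P) => [[/forallP H1 /'forall_forallP H2 /forallP H3]|[H1 H2 H3]].
  have Hlt (t t' : 'I_p) : (t < t')%N -> (i t + l t <= i t')%N.
    case: t' => k kp /=; elim: k kp => // k IH kp tk.
    have kp' : (k < p)%N := ltnW kp.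
    have step := implyP (H2 (Ordinal kp') (Ordinal kp)) (eqxx _).
    have [tk'|->] : (t < k)%N \/ t = Ordinal kp'.
      move: tk; rewrite ltnS leq_eqVlt => /orP[/eqP tk|]; last by left.
      by right; apply: val_inj.
    - by apply: leq_trans (IH kp' tk') _; apply: leq_trans step; apply: leq_addr.
    - exact: step.
  split=> // t; case: p l i l0 H1 H2 H3 Hlt t => [|p] l i l0 H1 H2 H3 Hlt t.
  - by case: t.
  - have i0 := implyP (H1 ord0) (eqxx _).
    have [t0|t0] := posnP t; first by have -> : t = ord0 by apply: val_inj.
    by have := Hlt ord0 t t0; lia.
  - by case: t.
  - have im := implyP (H3 ord_max) (eqxx _).
    have [->|tm] := eqVneq t ord_max; first by have := l0 ord_max; lia.
    have /Hlt : (t < @ord_max p)%N.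
      by rewrite ltn_neqAle -ltnS ltn_ord andbT.
    by have := l0 ord_max; lia.
split; first by apply/forallP => t; rewrite H1 implybT.
- apply/'forall_forallP => t t'; apply/implyP => /eqP tt'.
  by apply: H2; rewrite tt'.
- by apply/forallP => t; apply/implyP => _; have := H3 t; lia.
Qed.

(** The sum of the products over a, ..., a + c - 1 with p replaced blocks,
    summed by the position a + y of the last block: the other blocks lie in
    the window of the y cells before it. *)
Fixpoint blocks a p (l : 'I_p -> nat) (c : nat) {struct p} : {poly int} :=
  match p return ('I_p -> nat) -> {poly int} with
  | 0 => fun _ => \prod_(a <= x < a + c) (1 - 'X^x)
  | p1.+1 => fun l => \sum_(0 <= y < c.+1 - l ord_max)
     blocks a (fun t : 'I_p1 => l (lift ord_max t)) y *
     (- 'X^(a + y) * \prod_(a + y + l ord_max <= x < a + c) (1 - 'X^x))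
  end l.

Lemma admissibleS p a b c (l : 'I_p.+1 -> nat) N (x : 'I_N) (g : {ffun 'I_p -> 'I_N}) :
  (0 < a)%N -> b.+1 = (a + c)%N -> (forall t, (0 < l t)%N) ->
  admissible a b l (fun t => ffun_insert ord_max x g t) =
  [&& (a <= x)%N, (x + l ord_max <= b.+1)%N &
      admissible a x.-1 (fun t : 'I_p => l (lift ord_max t)) (fun t => g t)].
Proof.
move=> a0 bc l0; apply/admissibleP/and3P => // [[H1 H2 H3]|[ax xb]].
  have ax : (a <= x)%N by have := H1 ord_max; rewrite ffun_insert_id.
  split=> //; first by have := H3 ord_max; rewrite ffun_insert_id.
  apply/admissibleP => //; split=> [t|t t' tt'|t].
  - by have := H1 (lift ord_max t); rewrite ffun_insert_lift.
  - have := H2 (lift ord_max t) (lift ord_max t').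
    by rewrite !ffun_insert_lift !lift_max; apply.
  - have := H2 (lift ord_max t) ord_max.
    rewrite ffun_insert_lift ffun_insert_id lift_max prednK ?(leq_trans a0) //.
    by apply; apply: ltn_ord.
move=> /admissibleP[] // H1 H2 H3; split=> [t|t t' tt'|t].
- by case: (unliftP ord_max t) => [t' ->|->]; rewrite ?ffun_insert_lift ?ffun_insert_id.
- move: tt'; case: (unliftP ord_max t) => [u ->|->];
    case: (unliftP ord_max t') => [u' ->|->];
    rewrite ?ffun_insert_lift ?ffun_insert_id ?lift_max //.
  + exact: H2.
  + by move=> _; have := H3 u; rewrite prednK // (leq_trans a0).
  + by rewrite ltnNge ltnW ?(ltn_ord (u' : 'I_p)).
  + by rewrite ltnn.
- case: (unliftP ord_max t) => [u ->|->]; rewrite ?ffun_insert_lift ?ffun_insert_id //.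
  by have := H3 u; lia.
Qed.

Lemma Pi_repl_cons p a b (l : 'I_p.+1 -> nat) N (x : 'I_N)
    (g : {ffun 'I_p -> 'I_N}) :
  (0 < a <= x)%N -> (x + l ord_max <= b.+1)%N -> (forall t, (0 < l t)%N) ->
  admissible a x.-1 (fun t : 'I_p => l (lift ord_max t)) (fun t => g t) ->
  Pi_repl a b l (fun t => ffun_insert ord_max x g t) =
  Pi_repl a x.-1 (fun t : 'I_p => l (lift ord_max t)) (fun t => g t) *
  (- 'X^x * \prod_(x + l ord_max <= y < b.+1) (1 - 'X^y)).
Proof.
move=> /andP[a0 ax] xb l0 /admissibleP[] // _ _ H3.
have x0 : (0 < x)%N by apply: leq_trans ax.
rewrite prednK // in H3.
rewrite /Pi_repl prednK // big_ord_recr /= ffun_insert_id -!mulrA; congr (_ * _).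
  apply: eq_bigr => t _.
  have -> : widen_ord (leqnSn p) t = lift ord_max t.
    exact/val_inj/esym/lift_max.
  by rewrite ffun_insert_lift.
rewrite (big_cat_nat (n := x)) //=; last by apply: leq_trans xb; apply: leq_addr.
rewrite (big_cat_nat (m := x) (n := x + l ord_max)) ?leq_addr //=.
rewrite mulrCA; congr (_ * _).
  rewrite big_nat_cond [RHS]big_nat_cond; apply: eq_bigl => y.
  have [/andP[_ yx]/=|//] := boolP (a <= y < x)%N; congr (~~ _).
  apply/existsP/existsP => -[t].
    case: (unliftP ord_max t) => [t' ->|->].
      by rewrite ffun_insert_lift; exists t'.
    by rewrite ffun_insert_id; lia.
  by move=> yt; exists (lift ord_max t); rewrite ffun_insert_lift.
congr (_ * _).
rewrite big_nat_cond big_pred0 ?mul1r => [|y]; last first.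
  apply/negP => /andP[xy /existsP[]]; exists ord_max.
  by rewrite ffun_insert_id.
rewrite big_nat_cond [RHS]big_nat_cond; apply: eq_bigl => y.
have [/andP[xy _]/=|//] := boolP (x + l ord_max <= y < b.+1)%N.
apply/negP => /existsP[t]; case: (unliftP ord_max t) => [t' ->|->].
  by rewrite ffun_insert_lift; have := H3 t'; lia.
by rewrite ffun_insert_id; lia.
Qed.

Lemma sum_Pi_repl p a b c N (l : 'I_p -> nat) :
  (0 < a)%N -> b.+1 = (a + c)%N -> (b < N)%N -> (forall t, (0 < l t)%N) ->
  \sum_(i : {ffun 'I_p -> 'I_N} | admissible a b l (fun t => i t))
    Pi_repl a b l (fun t => i t) = blocks a l c.
Proof.
elim: p b c l => [|p IH] b c l a0 bc bN l0.
  rewrite (sum_ffun0 _ _ (ffun0 (card_ord 0))) ifT; last first.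
    by apply/admissibleP => //; split=> -[].
  rewrite /Pi_repl big_ord0 mul1r /= bc; apply: eq_bigl => x.
  by apply/negP => /existsP[[]].
rewrite (sum_ffun_insert ord_max) /=.
pose P x := ((a <= x)%N && (x + l ord_max <= b.+1)%N).
pose l' (t : 'I_p) := l (lift ord_max t).
pose F x := blocks a l' (x - a) *
  (- 'X^x * \prod_(x + l ord_max <= y < b.+1) (1 - 'X^y)).
transitivity (\sum_(x < N | P x) F x).
  rewrite [RHS]big_mkcond; apply: eq_bigr => x _.
  have [/andP[ax xb]|Px] := boolP (P x); last first.
    rewrite big_pred0 // => g; rewrite (admissibleS _ _ a0 bc l0) andbA.
    by rewrite -/(P x) (negbTE Px).
  have x0 : (0 < x)%N by apply: leq_trans ax.
  rewrite /F -(IH x.-1) ?prednK ?subnKC ?(ltnW (ltn_ord x)) //; last first.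
    by move=> t; apply: l0.
  rewrite big_distrl /=; apply: eq_big => [g|g adm].
    by rewrite (admissibleS _ _ a0 bc l0) ax xb.
  apply: Pi_repl_cons; rewrite ?a0 //.
  by move: adm; rewrite (admissibleS _ _ a0 bc l0) => /and3P[].
rewrite -(big_mkord P F) (big_cat_nat (n := a)) ?(leq_trans _ bN) //=; last first.
  by rewrite bc leq_addr.
rewrite big_nat_cond big_pred0 ?add0r => [|x]; last by rewrite /P; lia.
rewrite (big_cat_nat (n := a + c)) ?leq_addr //=; last by rewrite -bc.
rewrite [X in _ + X]big_nat_cond [X in _ + X]big_pred0 ?addr0 => [|x]; last first.
  by have := l0 ord_max; rewrite /P bc; lia.
rewrite -{1}[a]add0n big_addn addKn.
rewrite (big_nat_widen 0 (c.+1 - l ord_max) c); last first.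
  by have := l0 ord_max; lia.
apply: eq_big => [y|y _]; first by rewrite /P bc leq_addl; apply/idP/idP; lia.
by rewrite /F addnK [(y + a)%N]addnC bc.
Qed.

Lemma SigmaPiE p a b c (l : 'I_p -> nat) :
  (0 < a)%N -> b.+1 = (a + c)%N -> (forall t, (0 < l t)%N) ->
  SigmaPi a b l = blocks a l c.
Proof. by move=> a0 bc l0; apply: sum_Pi_repl. Qed.

(** The blocks d_1 + 1, ..., d_r + 1 for all compositions d of m into r parts,
    summed by the last part. *)
Fixpoint parts a r (m c : nat) : {poly int} :=
  if r is r1.+1 then
    \sum_(1 <= d < m.+1) \sum_(0 <= y < c - d) parts a r1 (m - d) y *
      (- 'X^(a + y) * \prod_(a + y + d.+1 <= x < a + c) (1 - 'X^x))
  else (m == 0%N)%:R * \prod_(a <= x < a + c) (1 - 'X^x).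

Lemma sum_blocks a r m c K : (m < K)%N ->
  \sum_(d : {ffun 'I_r -> 'I_K} |
       [forall x, (0 < d x)%N] && ((\sum_x d x)%N == m))
    blocks a (fun x => (d x).+1) c = parts a r m c.
Proof.
elim: r m c => [|r IH] m c mK.
  rewrite (sum_ffun0 _ _ (ffun0 (card_ord 0))) big_ord0 eq_sym /=.
  have -> : [forall x : 'I_0, (0 < (ffun0 (card_ord 0) x : 'I_K))%N].
    by apply/forallP => -[].
  by case: eqP => _; rewrite ?mul0r ?mul1r.
have PE x (g : {ffun 'I_r -> 'I_K}) :
    [forall t, (0 < ffun_insert ord_max x g t)%N] &&
      ((\sum_t ffun_insert ord_max x g t)%N == m) =
    (0 < x <= m)%N &&
      ([forall t, (0 < g t)%N] && ((\sum_t g t)%N == m - x)%N).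
  rewrite big_ord_recr /= ffun_insert_id.
  have -> : (\sum_(t < r) ffun_insert ord_max x g (widen_ord (leqnSn r) t) =
      \sum_(t < r) g t)%N.
    apply: eq_bigr => t _; rewrite -(ffun_insert_lift ord_max x g).
    by congr (nat_of_ord (ffun_insert _ _ _ _)); apply/val_inj/esym/lift_max.
  have -> : [forall t, (0 < ffun_insert ord_max x g t)%N] =
      (0 < x)%N && [forall t, (0 < g t)%N].
    apply/forallP/andP => [H|[x0 /forallP H] t].
      split; first by have := H ord_max; rewrite ffun_insert_id.
      by apply/forallP => t; have := H (lift ord_max t); rewrite ffun_insert_lift.
    by case: (unliftP ord_max t) => [t' ->|->]; rewrite ?ffun_insert_lift ?ffun_insert_id.
  rewrite -!andbA; congr (_ && _); rewrite andbCA; congr (_ && _).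
  by move: (\sum_(t < r) g t)%N => S; apply/eqP/andP => [|[? /eqP ?]]; lia.
rewrite (sum_ffun_insert ord_max) /=.
pose F d := \sum_(0 <= y < c - d) parts a r (m - d) y *
  (- 'X^(a + y) * \prod_(a + y + d.+1 <= x < a + c) (1 - 'X^x)).
transitivity (\sum_(d < K | (0 < d <= m)%N) F d).
  rewrite [RHS]big_mkcond; apply: eq_bigr => x _.
  under eq_bigl => g do rewrite PE.
  case: ifP => xm; last by rewrite big_pred0.
  under eq_bigr => g _ do rewrite ffun_insert_id subSS.
  rewrite exchange_big /=; apply: eq_bigr => y _.
  rewrite -big_distrl /= -(IH (m - x)%N) ?(leq_ltn_trans (leq_subr _ _)) //.
  congr (_ * _); apply: eq_bigr => g _; congr (blocks _ _ _).
  by apply/funext => t; rewrite ffun_insert_lift.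
rewrite -(big_mkord (fun d => 0 < d <= m)%N F) (big_cat_nat (n := 1)) //=; last first.
  by apply: leq_trans mK.
rewrite [X in X + _]big_nat_cond [X in X + _]big_pred0 ?add0r => [|x]; last lia.
rewrite (big_cat_nat (n := m.+1)) //=.
rewrite [X in _ + X]big_nat_cond [X in _ + X]big_pred0 ?addr0 => [|x]; last lia.
rewrite big_nat_cond [RHS]big_nat_cond; apply: eq_bigl => d.
by rewrite ltnS andbT andbb.
Qed.

Lemma parts0 a m c : (0 < m)%N -> parts a 0 m c = 0.
Proof. by case: m => // m _; rewrite /= mul0r. Qed.

(** The parts of a composition of m into r parts are positive, and its blocks
    fill m + r cells. *)
Lemma parts_eq0 a r m c : (m < r)%N || (c < m + r)%N -> parts a r m c = 0.
Proof.
elim: r m c => [|r IH] m c H.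
  by rewrite parts0 //; lia.
rewrite /= big_nat big1 // => d dm; rewrite big_nat big1 // => y yc.
by rewrite IH ?mul0r //; lia.
Qed.

(** The contribution of a last block that ends at the last cell a + c of a
    window of c + 1 cells. *)
Definition last_parts a r (m c : nat) : {poly int} :=
  \sum_(1 <= d < m.+1)
    if (d <= c)%N then - 'X^(a + (c - d)) * parts a r (m - d) (c - d) else 0.

Lemma partsS a r m c : parts a r.+1 m c.+1 =
  (1 - 'X^(a + c)) * parts a r.+1 m c + last_parts a r m c.
Proof.
rewrite /= big_distrr -big_split /=; apply: eq_big_nat => d /andP[d0 dm].
case: (leqP d c) => dc; last first.
  rewrite !(big_geq (n := _ - _)) ?mulr0 ?addr0 //; lia.
rewrite subSn // big_nat_recr //= [X in _ * (_ * X)]big_geq; last lia.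
rewrite mulr1 [X in _ + X]mulrC; congr (_ + _); rewrite big_distrr /=.
apply: eq_big_nat => y /andP[_ yc]; rewrite [(a + c.+1)%N]addnS big_nat_recr /=; last lia.
by ring.
Qed.

(** A last block with two cells gives the first term; a longer one is
    shortened by one cell while its starting point, hence its weight, stays
    the same. *)
Lemma last_partsS a r m c : last_parts a r m.+1 c.+1 =
  - 'X^(a + c) * parts a r m c + last_parts a r m c.
Proof.
rewrite /last_parts big_ltn // !subSS !subn0; congr (_ + _).
by rewrite big_add1.
Qed.

Definition all_parts a m c := \sum_(0 <= r < m.+1) parts a r m c.

Lemma all_partsE a m c R : (m < R)%N ->
  \sum_(0 <= r < R) parts a r m c = all_parts a m c.
Proof.
move=> mR; rewrite (big_cat_nat (n := m.+1)) //= [X in _ + X]big_nat.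
by rewrite [X in _ + X]big1 ?addr0 // => r /andP[mr _]; rewrite parts_eq0 ?mr.
Qed.

Lemma all_parts0 a c : all_parts a 0 c = \prod_(a <= x < a + c) (1 - 'X^x).
Proof. by rewrite /all_parts big_nat1 /= mul1r. Qed.

(** The blocks at the end of the window, shortened by one cell, end a window
    with one cell less, so by partsS they are the difference of two terms. *)
Lemma all_partsSS a m c : all_parts a m.+1 c.+2 =
  all_parts a m c.+1 + (1 - 'X^(a + c.+1)) * all_parts a m.+1 c.+1
  - all_parts a m c.
Proof.
have S1 n : \sum_(0 <= r < m.+2) parts a r m.+1 n =
    \sum_(0 <= r < m.+1) parts a r.+1 m.+1 n.
  by rewrite big_nat_recl //= mul0r add0r.
have S0 n : all_parts a m n =
    parts a 0 m n + \sum_(0 <= r < m.+1) parts a r.+1 m n.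
  by rewrite -(@all_partsE _ _ _ m.+2) // big_nat_recl.
have P0 : parts a 0 m c.+1 = (1 - 'X^(a + c)) * parts a 0 m c.
  by rewrite /= addnS big_nat_recr ?leq_addr //=; ring.
rewrite !S0 P0 /all_parts !S1.
under eq_bigr => r _ do rewrite partsS last_partsS.
under [X in _ = _ + X + _ - _]eq_bigr => r _ do rewrite partsS.
rewrite !big_split -!big_distrr.
rewrite [\big[_/_]_(0 <= r < m.+1) parts a r m c]S0.
set u := parts a 0 m c; set v := \sum_(0 <= r < m.+1) parts a r.+1 m c.
set w := \sum_(0 <= r < m.+1) parts a r.+1 m.+1 c.+1.
set z := \sum_(0 <= r < m.+1) last_parts a r m c.
by clearbody u v w z; rewrite /=; ring.
Qed.

(** The range of r in the bracket is cut where the terms vanish, by parts_eq0;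
    the term of the bracket without a composition is the term t = k. *)
Lemma bracketE j k : (1 <= k < j)%N ->
  bracket j k =
  \sum_(1 <= t < k.+1) (1 - psi t) * all_parts (t + 2) (k - t) (j - t - 1).
Proof.
move=> /andP[k1 kj]; rewrite big_nat_recr //= addrC /bracket; congr (_ + _).
  rewrite subnn all_parts0 /Pi; congr (_ * \prod_(_ <= _ < _) _); lia.
apply: eq_big_nat => t /andP[t1 tk]; congr (_ * _).
rewrite /all_parts [RHS]big_ltn // parts0 ?add0r; last lia.
rewrite [LHS](big_nat_widen _ _ (k - t).+1) ?ltnS ?geq_minr // big_mkcond.
apply: eq_big_nat => r /andP[r1 rk] /=.
case: ifP => [rm|rm]; last by rewrite parts_eq0 //; lia.
rewrite -(@sum_blocks _ _ _ _ (k - t).+1) //; apply: eq_bigr => d _.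
by apply: SigmaPiE; lia.
Qed.

(** * The bracket as the family b *)

Lemma bracket1 j : (2 <= j)%N -> bracket j 1 = \prod_(2 <= t < j.+1) (1 - 'X^t).
Proof.
move=> j2; rewrite bracketE // big_nat1 subnn all_parts0.
rewrite [RHS]big_ltn // /psi big_nat1; congr (_ * \prod_(_ <= _ < _) _); lia.
Qed.

Lemma bracket_pred j : (1 <= j)%N -> bracket j.+1 j = 1 - psi j.
Proof.
move=> j1; rewrite bracketE ?ltnSn ?j1 // big_nat_recr //= subnn all_parts0.
rewrite subSnn subnn addn0 [\prod_(_ <= _ < _) _]big_geq // mulr1 big_nat big1 ?add0r // => t tj.
rewrite /all_parts big1 ?mulr0 // => r _.
case: r => [|r]; last by rewrite parts_eq0 //; lia.
by rewrite parts0 //; lia.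
Qed.

Lemma psiS k : psi k.+1 = psi k + 'X^(k.+2).
Proof. by rewrite /psi big_nat_recr. Qed.

Lemma bracket_rec j k : (1 <= k <= j)%N ->
  bracket j.+3 k.+1 =
  bracket j.+2 k + (1 - 'X^(j.+3)) * bracket j.+2 k.+1 - bracket j.+1 k.
Proof.
move=> /andP[k1 kj]; rewrite !bracketE ?k1 ?ltnS ?(leqW kj) //; try lia.
rewrite (big_nat_recr k.+1) // [X in _ = _ + _ * X - _](big_nat_recr k.+1) //=.
rewrite subnn !all_parts0.
rewrite (_ : (k.+1 + 2 + (j.+3 - k.+1 - 1) = j.+4)%N); last lia.
rewrite (_ : (k.+1 + 2 + (j.+2 - k.+1 - 1) = j.+3)%N); last lia.
rewrite (big_nat_recr j.+3) /=; last lia.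
set P := \prod_(_ <= _ < _) _.
suff -> : \sum_(1 <= t < k.+1)
    (1 - psi t) * all_parts (t + 2) (k.+1 - t) (j.+3 - t - 1) =
  \sum_(1 <= t < k.+1)
    (1 - psi t) * all_parts (t + 2) (k - t) (j.+2 - t - 1) +
  (1 - 'X^(j.+3)) * (\sum_(1 <= t < k.+1)
    (1 - psi t) * all_parts (t + 2) (k.+1 - t) (j.+2 - t - 1)) -
  \sum_(1 <= t < k.+1)
    (1 - psi t) * all_parts (t + 2) (k - t) (j.+1 - t - 1) by ring.
rewrite big_distrr -big_split -sumrB /=; apply: eq_big_nat => t /andP[t1 tk].
have [-> -> ->] : [/\ (k.+1 - t = (k - t).+1)%N, (j.+3 - t - 1 = (j - t).+2)%N
   & (j.+2 - t - 1 = (j - t).+1)%N] by split; lia.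
rewrite all_partsSS (_ : (t + 2 + (j - t).+1 = j.+3)%N); last lia.
rewrite (_ : (j.+1 - t - 1 = j - t)%N); last lia.
by ring.
Qed.

Lemma bracket_bfamily :
  is_bfamily (fun j k => if k == j then 1 else bracket j k).
Proof.
split=> [j _|j j2|j k k2 kj].
- by rewrite eqxx.
- by rewrite ifN ?bracket1 // neq_ltn j2.
case: k k2 kj => [//|[//|k]] _ kj.
have -> : j = (j - k.+3 + k).+3 by lia.
move: (j - k.+3)%N => i; rewrite !subSS !subn0 !eqSS.
case: i => [|i].
  by rewrite add0n !eqxx !bracket_pred // psiS (ltn_eqF (ltnSn k)); ring.
rewrite !ifN; try lia.
by apply: bracket_rec; lia.
Qed.

Lemma chain_sum_bracket b n : is_bfamily b ->
  chain_sum n b = chain_sum n bracket.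
Proof.
move=> hb; rewrite !chain_sum_weight; apply: eq_bigr => s _; congr (_ * _).
apply: eq_chain_weight => j k /andP[k1 kj].
rewrite (is_bfamily_uniq hb bracket_bfamily) ?k1 ?(ltnW kj) // ifN //.
by rewrite neq_ltn kj.
Qed.

Lemma denominator_neq0 n : 'X^(n + 2) * (1 - 'X^2) != 0 :> {poly int}.
Proof.
apply: mulf_neq0; first exact/monic_neq0/monicXn.
rewrite subr_eq0.
by apply/eqP => /(congr1 (fun p : {poly int} => p`_0)); rewrite coef1 coefXn.
Qed.

Theorem corollary4p6 (b : nat -> nat -> {poly int}) (hb : is_bfamily b)
    (n : nat) (hn : (1 <= n)%N) :
  (poincare_fc n)%:F =
    - (('X^(n + 2) * (1 - 'X^2))%:F)^-1 * (chain_sum n b)%:F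
    :> {fraction {poly int}}
  /\
  - (('X^(n + 2) * (1 - 'X^2))%:F)^-1 * (chain_sum n b)%:F =
    - (('X^(n + 2) * (1 - 'X^2))%:F)^-1 * (chain_sum n bracket)%:F
    :> {fraction {poly int}}.
Proof.
rewrite -(chain_sum_bracket n hb); split=> //.
rewrite (chain_sum_jones n hb) -poincare_jones.
rewrite mulNr (mulNr _ (poincare_fc n)) tofracN mulrN opprK (tofracM _ (poincare_fc n)) mulKf //.
by rewrite tofrac_eq0 denominator_neq0.
Qed.
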